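(* Let $\Bbbk$ be a field and $\lambda\in\Bbbk$, $\lambda\neq 0$. The pair of varieties $(\mathrm{RB}_\lambda\mathrm{Com},\mathrm{postCom})$, with the functor $\psi$ sending a commutative Rota–Baxter algebra $\langle U,\cdot,R\rangle$ of weight $\lambda$ to the postcommutative algebra $\langle U,\succ,\perp\rangle$, $x\succ y=\tfrac1\lambda R(x)\cdot y$, $x\perp y=x\cdot y$, is a PBW-pair.
   Context: All algebras are over a field $\Bbbk$ and are not assumed to have a unit; ''commutative algebra'' means commutative and associative algebra. A linear operator $R$ on an algebra $A$ is a Rota–Baxter operator of weight $\lambda\in\Bbbk$ if $R(x)R(y)=R(R(x)y+xR(y)+\lambda xy)$ for all $x,y\in A$. $\mathrm{RB}_\lambda\mathrm{Com}$ is the variety of commutative algebras equipped with a Rota–Baxter operator of weight $\lambda$. If $R$ has weight $\lambda\neq0$, then $\frac1\lambda R$ is a Rota–Baxter operator of weight $1$. $\mathrm{postCom}$ is the variety of postcommutative algebras: vector spaces with two bilinear products $\succ,\perp$ such that $\perp$ is associative and commutative and $(x\succ y+y\succ x+x\perp y)\succ z=x\succ(y\succ z)$, $x\succ(y\perp z)=(x\succ y)\perp z$, $(x\succ y)\perp z=y\perp(x\succ z)$. PBW-pairs. Let $\mathcal V,\mathcal W$ be varieties of algebras and $\psi:\mathcal V\to\mathcal W$ a functor that preserves the underlying vector space of an algebra but changes the operations on it. For $A\in\mathcal W$, the universal enveloping algebra $U(A)\in\mathcal V$ is the image of $A$ under the left adjoint functor of $\psi$. It carries the natural ascending filtration $U_1(A)\subseteq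 U_2(A)\subseteq\dots$, where $U_n(A)$ is the linear span of all values in $U(A)$ of monomials in the operations of $\mathcal V$ (here: the multiplication and $R$) involving at most $n$ occurrences of elements of the image of $A$ (applying $R$ does not change this number); $\mathrm{gr}\,U(A)$ is the associated graded algebra in $\mathcal V$. $\mathrm{Ab}\,A$ denotes the vector space $A$ with all multiplicative operations trivial (zero). The pair $(\mathcal V,\mathcal W)$ with the functor $\psi$ is called a PBW-pair if $\mathrm{gr}\,U(A)\cong U(\mathrm{Ab}\,A)$ (isomorphism of algebras of $\mathcal V$) for every $A\in\mathcal W$. *)

(* Defs.v *)
From HB Require Import structures.
From mathcomp Require Import all_boot all_order all_algebra.
From mathcomp Require Import boolp.

Set Implicit Arguments.
Unset Strict Implicit.
Unset Printing Implicit Defensive.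

Import GRing.Theory.
Local Open Scope ring_scope.
Local Open Scope quotient_scope.

(* MathComp rings are unital, so non-unital algebras are bundled here as a
   vector space together with bilinear operations. *)
Record rbComAlg (K : fieldType) (lam : K) := RBComAlg {
  rb_car :> lmodType K;
  rb_mul : {bilinear rb_car -> rb_car -> rb_car};
  rb_op : {linear rb_car -> rb_car};
  rb_mulA : associative rb_mul;
  rb_mulC : commutative rb_mul;
  rb_opP : forall x y, rb_mul (rb_op x) (rb_op y) =
    rb_op (rb_mul (rb_op x) y + rb_mul x (rb_op y) + lam *: rb_mul x y)
}.

Record postCom (K : fieldType) := PostCom {
  pc_car :> lmodType K;
  pc_succ : {bilinear pc_car -> pc_car -> pc_car};
  pc_perp : {bilinear pc_car -> pc_car -> pc_car};
  pc_perpA : associative pc_perp;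
  pc_perpC : commutative pc_perp;
  pc_succA : forall x y z,
    pc_succ (pc_succ x y + pc_succ y x + pc_perp x y) z =
    pc_succ x (pc_succ y z);
  pc_succ_perp : forall x y z,
    pc_succ x (pc_perp y z) = pc_perp (pc_succ x y) z;
  pc_perp_succ : forall x y z,
    pc_perp (pc_succ x y) z = pc_perp y (pc_succ x z)
}.

Definition is_rb_hom (K : fieldType) (lam : K) (B C : rbComAlg lam)
    (f : {linear B -> C}) : Prop :=
  (forall x y, f (rb_mul B x y) = rb_mul C (f x) (f y)) /\
  (forall x, f (rb_op B x) = rb_op C (f x)).

Definition rb_isomorphic (K : fieldType) (lam : K) (B C : rbComAlg lam) : Prop :=
  exists f : {linear B -> C}, is_rb_hom f /\ bijective f.

Definition is_pc_hom (K : fieldType) (A B : postCom K)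
    (f : {linear A -> B}) : Prop :=
  (forall x y, f (pc_succ A x y) = pc_succ B (f x) (f y)) /\
  (forall x y, f (pc_perp A x y) = pc_perp B (f x) (f y)).

Section Psi.
Variables (K : fieldType) (lam : K) (lam0 : lam != 0) (B : rbComAlg lam).

Definition psi_succ (x y : B) : B := lam^-1 *: rb_mul B (rb_op B x) y.

Fact psi_succ_bilinear : bilinear_for *:%R *:%R psi_succ.
Proof.
split=> [y a x x'|x a y y']; rewrite /psi_succ.
  by rewrite linearP linearPl /= scalerDr !scalerA [a * _]mulrC.
by rewrite linearPr /= scalerDr !scalerA [a * _]mulrC.
Qed.

HB.instance Definition _ :=
  bilinear_isBilinear.Build K B B B *:%R *:%R psi_succ psi_succ_bilinear.

Fact psi_succA x y z :
  psi_succ (psi_succ x y + psi_succ y x + rb_mul B x y) z =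
  psi_succ x (psi_succ y z).
Proof.
have -> : psi_succ x y + psi_succ y x + rb_mul B x y =
    lam^-1 *: (rb_mul B (rb_op B x) y + rb_mul B x (rb_op B y)
               + lam *: rb_mul B x y).
  by rewrite !scalerDr scalerA mulVf // scale1r (rb_mulC x (rb_op B y)).
by rewrite /psi_succ linearZ linearZl /= -rb_opP linearZr /= rb_mulA.
Qed.

Fact psi_succ_perp x y z :
  psi_succ x (rb_mul B y z) = rb_mul B (psi_succ x y) z.
Proof. by rewrite /psi_succ linearZl /= rb_mulA. Qed.

Fact psi_perp_succ x y z :
  rb_mul B (psi_succ x y) z = rb_mul B y (psi_succ x z).
Proof.
by rewrite /psi_succ linearZl linearZr /= [in RHS]rb_mulA (rb_mulC y).
Qed.

Definition psi : postCom K :=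
  PostCom (rb_mulA (r := B)) (rb_mulC (r := B))
    psi_succA psi_succ_perp psi_perp_succ.

End Psi.

Lemma psi_hom (K : fieldType) (lam : K) (lam0 : lam != 0) (B C : rbComAlg lam)
    (f : {linear B -> C}) :
  is_rb_hom f -> is_pc_hom (A := psi lam0 B) (B := psi lam0 C) f.
Proof.
by case=> fM fR; split=> x y; rewrite /= ?fM // /psi_succ linearZ /= fM fR.
Qed.

Section Ab.
Variables (K : fieldType) (A : postCom K).

Definition ab_op (x y : A) : A := 0.

Fact ab_op_bilinear : bilinear_for *:%R *:%R ab_op.
Proof. by split=> ? ? ? ? /=; rewrite scaler0 addr0. Qed.

HB.instance Definition _ :=
  bilinear_isBilinear.Build K A A A *:%R *:%R ab_op ab_op_bilinear.

Fact ab_opA : associative ab_op. Proof. by []. Qed.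
Fact ab_opC : commutative ab_op. Proof. by []. Qed.
Fact ab_op_succA x y z :
  ab_op (ab_op x y + ab_op y x + ab_op x y) z = ab_op x (ab_op y z).
Proof. by []. Qed.
Fact ab_op_succ_perp x y z : ab_op x (ab_op y z) = ab_op (ab_op x y) z.
Proof. by []. Qed.
Fact ab_op_perp_succ x y z : ab_op (ab_op x y) z = ab_op y (ab_op x z).
Proof. by []. Qed.

Definition Ab : postCom K :=
  PostCom ab_opA ab_opC ab_op_succA ab_op_succ_perp ab_op_perp_succ.

End Ab.

(* (U, i) is the value at A of the left adjoint of psi together with the unit
   of the adjunction; it is unique up to a unique isomorphism. *)
Definition is_universal_enveloping (K : fieldType) (lam : K) (lam0 : lam != 0)
    (A : postCom K) (U : rbComAlg lam) (i : {linear A -> U}) : Prop :=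
  is_pc_hom (B := psi lam0 U) i /\
  forall (B : rbComAlg lam) (f : {linear A -> B}),
    is_pc_hom (B := psi lam0 B) f ->
    exists g : {linear U -> B},
      [/\ is_rb_hom g, forall a, g (i a) = f a &
          forall h : {linear U -> B},
            is_rb_hom h -> (forall a, h (i a) = f a) -> h =1 g].

(* Existence of the universal enveloping algebra: a model by generators and
   relations, with its universal property in [env_universal]. *)
Section Envelope.
Variables (K : fieldType) (lam : K) (lam0 : lam != 0) (A : postCom K).

Inductive env_term : Type :=
| EVar of A
| EZero
| EAdd of env_term & env_term
| EOpp of env_term
| EScale of K & env_term
| EMul of env_term & env_term
| EOp of env_term.

Inductive env_cong : env_term -> env_term -> Prop :=
| ec_refl s : env_cong s s
| ec_sym s t : env_cong s t -> env_cong t s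
| ec_trans s t u : env_cong s t -> env_cong t u -> env_cong s u
| ec_add s s' t t' : env_cong s s' -> env_cong t t' ->
    env_cong (EAdd s t) (EAdd s' t')
| ec_opp s s' : env_cong s s' -> env_cong (EOpp s) (EOpp s')
| ec_scale a s s' : env_cong s s' -> env_cong (EScale a s) (EScale a s')
| ec_mul s s' t t' : env_cong s s' -> env_cong t t' ->
    env_cong (EMul s t) (EMul s' t')
| ec_op s s' : env_cong s s' -> env_cong (EOp s) (EOp s')
| ec_addA s t u : env_cong (EAdd s (EAdd t u)) (EAdd (EAdd s t) u)
| ec_addC s t : env_cong (EAdd s t) (EAdd t s)
| ec_add0 s : env_cong (EAdd EZero s) s
| ec_addN s : env_cong (EAdd (EOpp s) s) EZero
| ec_scaleA a b s : env_cong (EScale a (EScale b s)) (EScale (a * b) s)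
| ec_scale1 s : env_cong (EScale 1 s) s
| ec_scaleDr a s t :
    env_cong (EScale a (EAdd s t)) (EAdd (EScale a s) (EScale a t))
| ec_scaleDl s a b :
    env_cong (EScale (a + b) s) (EAdd (EScale a s) (EScale b s))
| ec_mulA s t u : env_cong (EMul s (EMul t u)) (EMul (EMul s t) u)
| ec_mulC s t : env_cong (EMul s t) (EMul t s)
| ec_mulP a s s' t : env_cong (EMul (EAdd (EScale a s) s') t)
    (EAdd (EScale a (EMul s t)) (EMul s' t))
| ec_opL a s t : env_cong (EOp (EAdd (EScale a s) t)) (EAdd (EScale a (EOp s)) (EOp t))
| ec_opP s t : env_cong (EMul (EOp s) (EOp t))
    (EOp (EAdd (EAdd (EMul (EOp s) t) (EMul s (EOp t))) (EScale lam (EMul s t))))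
| ec_var a x y : env_cong (EVar (a *: x + y)) (EAdd (EScale a (EVar x)) (EVar y))
| ec_succ x y : env_cong (EVar (pc_succ A x y))
    (EScale lam^-1 (EMul (EOp (EVar x)) (EVar y)))
| ec_perp x y : env_cong (EVar (pc_perp A x y)) (EMul (EVar x) (EVar y)).

HB.instance Definition _ := gen_eqMixin env_term.
HB.instance Definition _ := gen_choiceMixin env_term.

Definition env_rel : rel env_term := fun s t => `[< env_cong s t >].

Fact env_rel_equiv : equiv_class_of env_rel.
Proof.
split=> [s|s t|t s u]; first by apply/asboolP/ec_refl.
  by apply/asboolP/asboolP; apply: ec_sym.
by move=> /asboolP st /asboolP tu; apply/asboolP/(ec_trans st tu).
Qed.

Canonical env_equiv := EquivRelPack env_rel_equiv.

Definition env := {eq_quot env_rel}.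
HB.instance Definition _ := Choice.on env.

Definition env_cls (s : env_term) : env := \pi_env s.

Lemma env_clsE s t : env_cls s = env_cls t <-> env_cong s t.
Proof.
split=> [/eqquotP/asboolP //|st]; apply/eqquotP; exact/asboolP.
Qed.

Lemma env_reprK (x : env) : env_cls (repr x) = x.
Proof. exact: reprK. Qed.

Lemma env_repr_cls s : env_cong (repr (env_cls s)) s.
Proof. by apply/env_clsE; rewrite env_reprK. Qed.

Lemma env_surj (x : env) : exists s, x = env_cls s.
Proof. by exists (repr x); rewrite env_reprK. Qed.

Definition env_add (x y : env) := env_cls (EAdd (repr x) (repr y)).
Definition env_opp (x : env) := env_cls (EOpp (repr x)).
Definition env_scale a (x : env) := env_cls (EScale a (repr x)).
Definition env_mul (x y : env) := env_cls (EMul (repr x) (repr y)).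
Definition env_op (x : env) := env_cls (EOp (repr x)).
Definition env_var (a : A) : env := env_cls (EVar a).

Lemma env_addE s t : env_add (env_cls s) (env_cls t) = env_cls (EAdd s t).
Proof. by apply/env_clsE/ec_add; apply: env_repr_cls. Qed.
Lemma env_oppE s : env_opp (env_cls s) = env_cls (EOpp s).
Proof. by apply/env_clsE/ec_opp; apply: env_repr_cls. Qed.
Lemma env_scaleE a s : env_scale a (env_cls s) = env_cls (EScale a s).
Proof. by apply/env_clsE/ec_scale; apply: env_repr_cls. Qed.
Lemma env_mulE s t : env_mul (env_cls s) (env_cls t) = env_cls (EMul s t).
Proof. by apply/env_clsE/ec_mul; apply: env_repr_cls. Qed.
Lemma env_opE s : env_op (env_cls s) = env_cls (EOp s).
Proof. by apply/env_clsE/ec_op; apply: env_repr_cls. Qed.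

Let envE := (env_addE, env_oppE, env_scaleE, env_mulE, env_opE).

Fact env_addA : associative env_add.
Proof.
move=> x y z; have [s ->] := env_surj x; have [t ->] := env_surj y.
by have [u ->] := env_surj z; rewrite !envE; apply/env_clsE/ec_addA.
Qed.
Fact env_addC : commutative env_add.
Proof.
move=> x y; have [s ->] := env_surj x; have [t ->] := env_surj y.
by rewrite !envE; apply/env_clsE/ec_addC.
Qed.
Fact env_add0 : left_id (env_cls EZero) env_add.
Proof.
by move=> x; have [s ->] := env_surj x; rewrite !envE; apply/env_clsE/ec_add0.
Qed.
Fact env_addN : left_inverse (env_cls EZero) env_opp env_add.
Proof.
by move=> x; have [s ->] := env_surj x; rewrite !envE; apply/env_clsE/ec_addN.
Qed.

HB.instance Definition _ :=
  GRing.isZmodule.Build env env_addA env_addC env_add0 env_addN.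

Fact env_scaleA a b x : env_scale a (env_scale b x) = env_scale (a * b) x.
Proof.
by have [s ->] := env_surj x; rewrite !envE; apply/env_clsE/ec_scaleA.
Qed.
Fact env_scale1 : left_id 1 env_scale.
Proof.
by move=> x; have [s ->] := env_surj x; rewrite !envE; apply/env_clsE/ec_scale1.
Qed.
Fact env_scaleDr : right_distributive env_scale +%R.
Proof.
move=> a x y; have [s ->] := env_surj x; have [t ->] := env_surj y.
by rewrite /GRing.add /= !envE; apply/env_clsE/ec_scaleDr.
Qed.
Fact env_scaleDl x : {morph env_scale^~ x : a b / a + b}.
Proof.
move=> a b; have [s ->] := env_surj x.
by rewrite [in RHS]/GRing.add /= !envE; apply/env_clsE/ec_scaleDl.
Qed.

HB.instance Definition _ := GRing.Zmodule_isLmodule.Build K env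
  env_scaleA env_scale1 env_scaleDr env_scaleDl.

Lemma env_clsD s t : env_cls (EAdd s t) = env_cls s + env_cls t.
Proof. by rewrite -env_addE. Qed.
Lemma env_clsZ a s : env_cls (EScale a s) = a *: env_cls s.
Proof. by rewrite -env_scaleE. Qed.

Fact env_mulA : associative env_mul.
Proof.
move=> x y z; have [s ->] := env_surj x; have [t ->] := env_surj y.
by have [u ->] := env_surj z; rewrite !envE; apply/env_clsE/ec_mulA.
Qed.
Fact env_mulC : commutative env_mul.
Proof.
move=> x y; have [s ->] := env_surj x; have [t ->] := env_surj y.
by rewrite !envE; apply/env_clsE/ec_mulC.
Qed.
Fact env_mulPl a x x' y :
  env_mul (a *: x + x') y = a *: env_mul x y + env_mul x' y.
Proof.
have [s ->] := env_surj x; have [s' ->] := env_surj x'.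
have [t ->] := env_surj y.
rewrite -env_clsZ -env_clsD !envE -env_clsZ -env_clsD.
exact/env_clsE/ec_mulP.
Qed.
Fact env_mul_bilinear : bilinear_for *:%R *:%R env_mul.
Proof.
split=> [y a x x'|y a x x']; first exact: env_mulPl.
by rewrite ![env_mul y _]env_mulC env_mulPl.
Qed.

HB.instance Definition _ :=
  bilinear_isBilinear.Build K env env env *:%R *:%R env_mul env_mul_bilinear.

Fact env_op_linear : linear env_op.
Proof.
move=> a x y; have [s ->] := env_surj x; have [t ->] := env_surj y.
rewrite -env_clsZ -env_clsD !envE -env_clsZ -env_clsD.
exact/env_clsE/ec_opL.
Qed.

HB.instance Definition _ :=
  GRing.isLinear.Build K env env *:%R env_op env_op_linear.

Fact env_opP x y : env_mul (env_op x) (env_op y) =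
  env_op (env_mul (env_op x) y + env_mul x (env_op y) + lam *: env_mul x y).
Proof.
have [s ->] := env_surj x; have [t ->] := env_surj y.
rewrite (env_opE s) (env_opE t) !env_mulE -env_clsZ -!env_clsD env_opE.
exact/env_clsE/ec_opP.
Qed.

Definition env_alg : rbComAlg lam := RBComAlg env_mulA env_mulC env_opP.

Fact env_var_linear : linear (env_var : A -> env_alg).
Proof.
move=> a x y; transitivity (env_cls (EAdd (EScale a (EVar x)) (EVar y))).
  exact/env_clsE/ec_var.
by rewrite env_clsD env_clsZ.
Qed.

HB.instance Definition _ :=
  GRing.isLinear.Build K A env_alg *:%R env_var env_var_linear.

Definition env_unit : {linear A -> env_alg} := env_var.

Section Lift.
Variables (B : rbComAlg lam) (f : {linear A -> B}).
Hypothesis fP : is_pc_hom (B := psi lam0 B) f.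

Fixpoint env_eval (s : env_term) : B :=
  match s with
  | EVar a => f a
  | EZero => 0
  | EAdd s t => env_eval s + env_eval t
  | EOpp s => - env_eval s
  | EScale a s => a *: env_eval s
  | EMul s t => rb_mul B (env_eval s) (env_eval t)
  | EOp s => rb_op B (env_eval s)
  end.

Lemma env_eval_cong s t : env_cong s t -> env_eval s = env_eval t.
Proof.
have [fS fT] := fP; elim=> //= *; first
  [ congruence | exact: addrA | exact: addrC | exact: add0r | exact: addNr
  | exact: scalerA | exact: scale1r | exact: scalerDr | exact: scalerDl
  | exact: rb_mulA | exact: rb_mulC | exact: linearPl | exact: linearP
  | exact: rb_opP | exact: fS | exact: fT ].
Qed.

Definition env_lift (x : env_alg) : B := env_eval (repr (x : env)).

Lemma env_liftE s : env_lift (env_cls s) = env_eval s.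
Proof. exact/env_eval_cong/env_repr_cls. Qed.

Fact env_lift_linear : linear env_lift.
Proof.
move=> a x y; have [s ->] := env_surj x; have [t ->] := env_surj y.
transitivity (env_lift (env_cls (EAdd (EScale a s) t))).
  by rewrite env_clsD env_clsZ.
by rewrite !env_liftE.
Qed.

HB.instance Definition _ :=
  GRing.isLinear.Build K env_alg B *:%R env_lift env_lift_linear.

Definition env_lift_lin : {linear env_alg -> B} := env_lift.

Lemma env_lift_hom : is_rb_hom env_lift_lin.
Proof.
split=> [x y|x]; have [s ->] := env_surj x.
  have [t ->] := env_surj y.
  by rewrite /= env_mulE !env_liftE.
by rewrite /= env_opE !env_liftE.
Qed.

Lemma env_lift_uniq (h : {linear env_alg -> B}) :
  is_rb_hom h -> (forall a, h (env_var a) = f a) -> h =1 env_lift_lin.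
Proof.
move=> [hM hR] hv x; have [s ->] := env_surj x; rewrite /= env_liftE.
elim: s => [a||s IHs t IHt|s IHs|a s IHs|s IHs t IHt|s IHs] /=.
- exact: hv.
- exact: (linear0 h).
- by rewrite env_clsD -IHs -IHt; apply: (linearD h).
- by rewrite -env_oppE -IHs; apply: (linearN h).
- by rewrite env_clsZ -IHs; apply: (linearZ_LR h).
- by rewrite -env_mulE -IHs -IHt; apply: hM.
- by rewrite -env_opE -IHs; apply: hR.
Qed.

End Lift.

Theorem env_universal : is_universal_enveloping lam0 env_unit.
Proof.
split.
  split=> x y /=.
    transitivity (env_cls (EScale lam^-1 (EMul (EOp (EVar x)) (EVar y)))).
      exact/env_clsE/ec_succ.
    by rewrite env_clsZ -env_mulE -env_opE.
  by rewrite env_mulE; apply/env_clsE/ec_perp.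
move=> B f fP; exists (env_lift_lin fP); split.
- exact: env_lift_hom.
- by move=> a; rewrite /= env_liftE.
- by move=> h; apply: env_lift_uniq.
Qed.

End Envelope.

Section LmodQuotient.
Variables (K : fieldType) (V : lmodType K) (S : submodClosed V).

(* A generic [submodClosed] carries no [zmodClosed] instance, which the
   library's quotients require; this copy of S does. *)
Definition submod_pred : {pred V} := S.
Fact submod_pred_closed : submod_closed submod_pred.
Proof. by split=> [|a x y]; [exact: rpred0 | move=> xS yS; rewrite rpredD ?rpredZ]. Qed.
HB.instance Definition _ :=
  GRing.isSubmodClosed.Build K V submod_pred submod_pred_closed.

Definition lquot := Quotient.quot submod_pred.
HB.instance Definition _ := GRing.Zmodule.on lquot.

Definition lclass (x : V) : lquot := \pi_(Quotient.quot submod_pred) x.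

Definition lrepr (q : lquot) : V := repr (q : Quotient.quot submod_pred).

Lemma lreprK q : lclass (lrepr q) = q.
Proof. exact: reprK. Qed.

Lemma lclass_eq x y : (lclass x = lclass y) <-> (x - y \in S).
Proof.
rewrite -[S : {pred V}]/submod_pred (Quotient.idealrBE submod_pred); split=> [h|/eqP//]; exact/eqP.
Qed.

Lemma lclassD x y : lclass (x + y) = lclass x + lclass y.
Proof. by rewrite /lclass -(@pi_addr _ _ _ _ _ (Quotient.quot submod_pred)). Qed.

Lemma lclass_surj (q : lquot) : exists x, q = lclass x.
Proof. by exists (lrepr q); rewrite lreprK. Qed.

Definition lquot_scale (a : K) (q : lquot) : lquot := lclass (a *: lrepr q).

Lemma lquot_scaleE a x : lquot_scale a (lclass x) = lclass (a *: x).
Proof.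
apply/lclass_eq; rewrite -scalerBr rpredZ //; apply/lclass_eq.
by rewrite lreprK.
Qed.

Fact lquot_scaleA a b q :
  lquot_scale a (lquot_scale b q) = lquot_scale (a * b) q.
Proof. by have [x ->] := lclass_surj q; rewrite !lquot_scaleE scalerA. Qed.
Fact lquot_scale1 : left_id 1 lquot_scale.
Proof. by move=> q; have [x ->] := lclass_surj q; rewrite lquot_scaleE scale1r. Qed.
Fact lquot_scaleDr : right_distributive lquot_scale +%R.
Proof.
move=> a p q; have [x ->] := lclass_surj p; have [y ->] := lclass_surj q.
by rewrite !lquot_scaleE -!lclassD lquot_scaleE scalerDr.
Qed.
Fact lquot_scaleDl q : {morph lquot_scale^~ q : a b / a + b}.
Proof.
by move=> a b; have [x ->] := lclass_surj q; rewrite !lquot_scaleE scalerDl lclassD.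
Qed.

HB.instance Definition _ := GRing.Zmodule_isLmodule.Build K lquot
  lquot_scaleA lquot_scale1 lquot_scaleDr lquot_scaleDl.

Fact lclass_linear : linear lclass.
Proof. by move=> a x y; rewrite lclassD -lquot_scaleE. Qed.

HB.instance Definition _ := GRing.isLinear.Build K V lquot *:%R lclass lclass_linear.

End LmodQuotient.

Section DirectSum.
Variables (K : fieldType) (V : nat -> lmodType K).

Record dsum := DSum {
  dsum_val :> forall n, V n;
  _ : exists N, forall n, (N <= n)%N -> dsum_val n = 0
}.

HB.instance Definition _ := gen_eqMixin dsum.
HB.instance Definition _ := gen_choiceMixin dsum.

Lemma dsumP (f g : dsum) : (forall n, f n = g n) -> f = g.
Proof.
case: f g => [f f0] [g g0] /= fg.
have {}fg : f = g by apply: functional_extensionality_dep.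
by case: _ / fg in g0 *; congr DSum; apply: Prop_irrelevance.
Qed.

Fact dsum_zero_fin : exists N, forall n, (N <= n)%N -> (0 : V n) = 0.
Proof. by exists 0%N. Qed.
Definition dsum_zero : dsum := DSum dsum_zero_fin.

Fact dsum_opp_fin (f : dsum) :
  exists N, forall n, (N <= n)%N -> - f n = 0.
Proof. by case: f => f [N f0]; exists N => n /f0 /= ->; rewrite oppr0. Qed.
Definition dsum_opp f : dsum := DSum (dsum_opp_fin f).

Fact dsum_add_fin (f g : dsum) :
  exists N, forall n, (N <= n)%N -> f n + g n = 0.
Proof.
case: f g => f [M f0] [g [N g0]]; exists (maxn M N) => n /=.
by rewrite geq_max => /andP[/f0-> /g0->]; rewrite addr0.
Qed.
Definition dsum_add f g : dsum := DSum (dsum_add_fin f g).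

Fact dsum_scale_fin a (f : dsum) :
  exists N, forall n, (N <= n)%N -> a *: f n = 0.
Proof. by case: f => f [N f0]; exists N => n /f0 /= ->; rewrite scaler0. Qed.
Definition dsum_scale a f : dsum := DSum (dsum_scale_fin a f).

Fact dsum_addA : associative dsum_add.
Proof. by move=> f g h; apply: dsumP => n /=; rewrite addrA. Qed.
Fact dsum_addC : commutative dsum_add.
Proof. by move=> f g; apply: dsumP => n /=; rewrite addrC. Qed.
Fact dsum_add0 : left_id dsum_zero dsum_add.
Proof. by move=> f; apply: dsumP => n /=; rewrite add0r. Qed.
Fact dsum_addN : left_inverse dsum_zero dsum_opp dsum_add.
Proof. by move=> f; apply: dsumP => n /=; rewrite addNr. Qed.

HB.instance Definition _ :=
  GRing.isZmodule.Build dsum dsum_addA dsum_addC dsum_add0 dsum_addN.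

Fact dsum_scaleA a b f : dsum_scale a (dsum_scale b f) = dsum_scale (a * b) f.
Proof. by apply: dsumP => n /=; rewrite scalerA. Qed.
Fact dsum_scale1 : left_id 1 dsum_scale.
Proof. by move=> f; apply: dsumP => n /=; rewrite scale1r. Qed.
Fact dsum_scaleDr : right_distributive dsum_scale +%R.
Proof. by move=> a f g; apply: dsumP => n /=; rewrite scalerDr. Qed.
Fact dsum_scaleDl f : {morph dsum_scale^~ f : a b / a + b}.
Proof. by move=> a b; apply: dsumP => n /=; rewrite scalerDl. Qed.

HB.instance Definition _ := GRing.Zmodule_isLmodule.Build K dsum
  dsum_scaleA dsum_scale1 dsum_scaleDr dsum_scaleDl.

Lemma dsumDE (f g : dsum) n : (f + g) n = f n + g n. Proof. by []. Qed.
Lemma dsumZE a (f : dsum) n : (a *: f) n = a *: f n. Proof. by []. Qed.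

End DirectSum.

Definition in_span (K : fieldType) (V : lmodType K) (S : V -> Prop)
    (u : V) : Prop :=
  exists (m : nat) (c : 'I_m -> K) (v : 'I_m -> V),
    (forall j, S (v j)) /\ u = \sum_(j < m) c j *: v j.

Section InSpan.
Variables (K : fieldType) (V : lmodType K).
Implicit Types (S T : V -> Prop).

Lemma in_span_gen S u : S u -> in_span S u.
Proof.
by move=> Su; exists 1%N, (fun=> 1), (fun=> u); rewrite big_ord1 scale1r.
Qed.

Lemma in_span0 S : in_span S 0.
Proof.
exists 0%N, (fun=> 0), (fun=> 0).
by split; [case | rewrite big_ord0].
Qed.

Lemma in_spanD S u v : in_span S u -> in_span S v -> in_span S (u + v).
Proof.
move=> [m [c [x [Sx ->]]]] [n [d [y [Sy ->]]]].
exists (m + n)%N, (fun j => match split j with inl i => c i | inr i => d i end),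
  (fun j => match split j with inl i => x i | inr i => y i end); split.
  by move=> j; case: (split j).
rewrite big_split_ord /=; congr (_ + _); apply: eq_bigr => j _.
  by rewrite (unsplitK (inl j)).
by rewrite (unsplitK (inr j)).
Qed.

Lemma in_spanZ S a u : in_span S u -> in_span S (a *: u).
Proof.
move=> [m [c [x [Sx ->]]]]; exists m, (fun j => a * c j), x; split=> //.
by rewrite scaler_sumr; apply: eq_bigr => j _; rewrite scalerA.
Qed.

Lemma in_span_sum S n (F : 'I_n -> V) :
  (forall j, in_span S (F j)) -> in_span S (\sum_j F j).
Proof.
by move=> SF; elim/big_rec: _ => [|j u _]; [exact: in_span0 | exact: in_spanD].
Qed.

End InSpan.

Section Graded.
Variables (K : fieldType) (lam : K) (U : rbComAlg lam) (X : Type) (i : X -> U).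

Inductive monomial_value : nat -> U -> Prop :=
| MVgen x : monomial_value 1 (i x)
| MVmul m n u v : monomial_value m u -> monomial_value n v ->
    monomial_value (m + n) (rb_mul U u v)
| MVop n u : monomial_value n u -> monomial_value n (rb_op U u).

Definition filt (n : nat) : {pred U} := fun u =>
  `[< in_span (fun v => exists2 m, (m <= n)%N & monomial_value m v) u >].

Fact filt_submod_closed n : submod_closed (filt n).
Proof.
split=> [|a u v /asboolP Fu /asboolP Fv]; apply/asboolP; first exact: in_span0.
exact/in_spanD/Fv/in_spanZ.
Qed.

HB.instance Definition _ n :=
  GRing.isSubmodClosed.Build K U (filt n) (filt_submod_closed n).

Lemma monomial_value_gt0 n u : monomial_value n u -> (0 < n)%N.
Proof. by elim=> // m k v w _ m0 _ _; rewrite addn_gt0 m0. Qed.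

Lemma filt0 u : u \in filt 0 -> u = 0.
Proof.
move=> /asboolP[m [c [v [Fv ->]]]]; apply: big1 => j _.
by have [[|k] // _ /monomial_value_gt0] := Fv j.
Qed.

Lemma filtW m n u : (m <= n)%N -> u \in filt m -> u \in filt n.
Proof.
move=> mn /asboolP[k [c [v [Fv ->]]]]; apply/asboolP; exists k, c, v; split=> //.
by move=> j; have [l lm ?] := Fv j; exists l => //; apply: leq_trans mn.
Qed.

Lemma filt_mul m n u v :
  u \in filt m -> v \in filt n -> rb_mul U u v \in filt (m + n).
Proof.
move=> /asboolP[k [c [x [Fx ->]]]] /asboolP[l [d [y [Fy ->]]]]; apply/asboolP.
rewrite linear_sumlz; apply: in_span_sum => a.
rewrite linear_sumr; apply: in_span_sum => b.
rewrite linearZl_LR linearZr_LR; apply/in_spanZ/in_spanZ/in_span_gen.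
have [p pm ?] := Fx a; have [q qn ?] := Fy b.
by exists (p + q)%N; [exact: leq_add | exact: MVmul].
Qed.

Lemma filt_op n u : u \in filt n -> rb_op U u \in filt n.
Proof.
move=> /asboolP[k [c [x [Fx ->]]]]; apply/asboolP.
rewrite linear_sum; apply: in_span_sum => a.
rewrite linearZ; apply/in_spanZ/in_span_gen.
by have [p pm ?] := Fx a; exists p => //; exact: MVop.
Qed.

Record filtT (n : nat) := FiltT { filt_val : U; _ : filt_val \in filt n }.

HB.instance Definition _ n := [isSub for @filt_val n].
HB.instance Definition _ n := [Choice of filtT n by <:].
HB.instance Definition _ n := [SubChoice_isSubLmodule of filtT n by <:].

Lemma filt_valP n (u : filtT n) : filt_val u \in filt n.
Proof. exact: valP. Qed.

Fact filt_val_linear n : linear (@filt_val n).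
Proof. by move=> a u v; rewrite -[filt_val _]/(val _) linearP. Qed.

HB.instance Definition _ n :=
  GRing.isLinear.Build K (filtT n) U *:%R (@filt_val n) (@filt_val_linear n).

Definition lower (n : nat) : {pred filtT n} := fun u => filt_val u \in filt n.-1.
Arguments lower n u : clear implicits.

Fact lower_submod_closed n : submod_closed (lower n).
Proof.
split=> [|a u v Fu Fv]; rewrite unfold_in /lower; first by rewrite raddf0 rpred0.
by rewrite linearP rpredD // rpredZ.
Qed.

HB.instance Definition _ n := GRing.isSubmodClosed.Build K (filtT n) (lower n)
  (lower_submod_closed n).

Definition grp (n : nat) : lmodType K := lquot (lower n).

Fact filt_mul_at j k n (e : (j + k)%N = n) (u : filtT j) (v : filtT k) :
  rb_mul U (filt_val u) (filt_val v) \in filt n.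
Proof. by rewrite -e filt_mul ?filt_valP. Qed.

Definition grp_mul j k n (e : (j + k)%N = n) (p : grp j) (q : grp k) : grp n :=
  lclass (lower n) (FiltT (filt_mul_at e (lrepr p) (lrepr q))).

Definition grp_op n (p : grp n) : grp n :=
  lclass (lower n) (FiltT (filt_op (filt_valP (lrepr p)))).

(* [grp_cls n u] is meaningful for u in [filt n] only. *)
Definition grp_cls n (u : U) : grp n := lclass (lower n) (insubd 0 u).

Lemma grp_cls_val n (u : filtT n) : grp_cls n (filt_val u) = lclass (lower n) u.
Proof. by rewrite /grp_cls -[filt_val u]/(val u) valKd. Qed.

Lemma grp_clsE n u (Fu : u \in filt n) : grp_cls n u = lclass (lower n) (FiltT Fu).
Proof. by rewrite -grp_cls_val. Qed.

Lemma grp_cls_eq n u v : u \in filt n -> v \in filt n ->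
  (grp_cls n u = grp_cls n v) <-> (u - v \in filt n.-1).
Proof.
move=> Fu Fv; rewrite (grp_clsE Fu) (grp_clsE Fv).
split=> [/lclass_eq|Fuv]; first by rewrite unfold_in /lower raddfB.
by apply/lclass_eq; rewrite unfold_in /lower raddfB.
Qed.

Lemma grp_clsP n a u v : u \in filt n -> v \in filt n ->
  grp_cls n (a *: u + v) = a *: grp_cls n u + grp_cls n v.
Proof.
move=> Fu Fv; rewrite (grp_clsE Fu) (grp_clsE Fv) -linearP /= -grp_cls_val.
by rewrite linearP.
Qed.

Lemma grp_cls0 n : grp_cls n 0 = 0.
Proof.
by have := grp_cls_val (0 : filtT n); rewrite raddf0 => ->; rewrite linear0.
Qed.

Lemma grp_cls_sum n m (F : 'I_m -> U) : (forall j, F j \in filt n) ->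
  grp_cls n (\sum_j F j) = \sum_j grp_cls n (F j).
Proof.
move=> FF; suff [] : \sum_j F j \in filt n /\
    grp_cls n (\sum_j F j) = \sum_j grp_cls n (F j) by [].
elim/big_rec2: _ => [|j p u _ [Fu IH]]; first by rewrite rpred0 grp_cls0.
by rewrite rpredD // -[F j]scale1r grp_clsP // IH !scale1r.
Qed.

Lemma grp_rep n (p : grp n) :
  filt_val (lrepr p) \in filt n /\ p = grp_cls n (filt_val (lrepr p)).
Proof. by rewrite grp_cls_val lreprK filt_valP. Qed.

Lemma filt_mul_predl j k u v :
  u \in filt j.-1 -> v \in filt k -> rb_mul U u v \in filt (j + k).-1.
Proof.
case: j => [|j] Fu Fv; last exact: filt_mul.
by rewrite (filt0 Fu) linear0l rpred0.
Qed.

Lemma filt_mul_predr j k u v :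
  u \in filt j -> v \in filt k.-1 -> rb_mul U u v \in filt (j + k).-1.
Proof. by move=> Fu Fv; rewrite rb_mulC addnC; apply: filt_mul_predl. Qed.

Lemma grp_mulE j k n (e : (j + k)%N = n) u v : u \in filt j -> v \in filt k ->
  grp_mul e (grp_cls j u) (grp_cls k v) = grp_cls n (rb_mul U u v).
Proof.
move=> Fu Fv; rewrite /grp_mul -grp_cls_val /=.
have [Fu' /esym eu] := grp_rep (grp_cls j u).
have [Fv' /esym ev] := grp_rep (grp_cls k v).
set u' := filt_val _ in Fu' eu *; set v' := filt_val _ in Fv' ev *.
apply/grp_cls_eq; rewrite -?e ?filt_mul //.
have -> : rb_mul U u' v' - rb_mul U u v =
    rb_mul U (u' - u) v' + rb_mul U u (v' - v).
  by rewrite linearBl linearBr addrA subrK.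
rewrite rpredD //; first by apply: filt_mul_predl => //; apply/grp_cls_eq.
by apply: filt_mul_predr => //; apply/grp_cls_eq.
Qed.

Lemma grp_opE n u : u \in filt n ->
  grp_op (grp_cls n u) = grp_cls n (rb_op U u).
Proof.
move=> Fu; rewrite /grp_op -grp_cls_val /=.
have [] := grp_rep (grp_cls n u).
move: (filt_val _) => u' Fu' /esym eu.
apply/grp_cls_eq; rewrite ?filt_op // -linearB filt_op //.
exact/grp_cls_eq.
Qed.

Definition gr_fun (f g : dsum grp) (n : nat) : grp n :=
  \sum_(k < n.+1) grp_mul (subnKC (leq_ord k)) (f k) (g (n - k)%N).

Fact gr_mul_fin (f g : dsum grp) :
  exists N, forall n, (N <= n)%N -> gr_fun f g n = 0.
Proof.
case: f g => f [M f0] [g [N g0]]; exists (M + N)%N => n Mn.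
apply: big1 => k _ /=; set e := subnKC _; move: e.
have [/f0->|kM] := leqP M k => e; last first.
  rewrite g0; last by rewrite leq_subRL ?leq_ord // (leq_trans _ Mn) // leq_add2r ltnW.
  have [Fu ->] := grp_rep (f k).
  by rewrite -grp_cls0 grp_mulE ?rpred0 // linear0r grp_cls0.
have [Fv ->] := grp_rep (g (n - k)%N).
by rewrite -grp_cls0 grp_mulE ?rpred0 // linear0l grp_cls0.
Qed.

Definition gr_mul (f g : dsum grp) : dsum grp := DSum (gr_mul_fin f g).

Fact gr_op_fin (f : dsum grp) :
  exists N, forall n, (N <= n)%N -> grp_op (f n) = 0.
Proof.
case: f => f [N f0]; exists N => n /f0 /= ->.
by rewrite -grp_cls0 grp_opE ?rpred0 // linear0 grp_cls0.
Qed.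

Definition gr_op (f : dsum grp) : dsum grp := DSum (gr_op_fin f).

Definition conv (u v : nat -> U) (n : nat) : U :=
  \sum_(k < n.+1) rb_mul U (u k) (v (n - k)%N).

Lemma conv_rev u v n :
  conv u v n = \sum_(k < n.+1) rb_mul U (u (n - k)%N) (v k).
Proof.
rewrite /conv (reindex_inj rev_ord_inj) /=.
by apply: eq_bigr => k _; rewrite (sub_ordK k) subSS.
Qed.

Lemma convC u v n : conv u v n = conv v u n.
Proof. by rewrite conv_rev; apply: eq_bigr => k _; rewrite rb_mulC. Qed.

Lemma convA u v w n : conv u (conv v w) n = conv (conv u v) w n.
Proof.
rewrite [RHS]conv_rev.
pose F j k := rb_mul U (u j) (rb_mul U (v (n - j - k)%N) (w k)).
transitivity (\sum_(j < n.+1) \sum_(k < n.+1 | (k <= n - j)%N) F j k).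
  apply: eq_bigr => /= j _; rewrite conv_rev linear_sumr /=.
  by rewrite (big_ord_narrow_leq (leq_subr _ _)).
rewrite (exchange_big_dep predT) //=; apply: eq_bigr => k _.
transitivity (\sum_(j < n.+1 | (j <= n - k)%N) F j k).
  apply: eq_bigl => j; rewrite -ltnS -(ltnS j) -!subSn ?leq_ord //.
  by rewrite -subn_gt0 -(subn_gt0 j) -!subnDA addnC.
rewrite (big_ord_narrow_leq (leq_subr _ _)) /conv linear_sumlz /=.
by apply: eq_bigr => j _; rewrite /F -!subnDA addnC rb_mulA.
Qed.

Lemma convP a u u' v n :
  conv (fun k => a *: u k + u' k) v n = a *: conv u v n + conv u' v n.
Proof.
by rewrite /conv scaler_sumr -big_split; apply: eq_bigr => k _; rewrite linearPl.
Qed.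

Definition represents (f : dsum grp) (u : nat -> U) : Prop :=
  forall n, u n \in filt n /\ f n = grp_cls n (u n).

Lemma represents_ex f : exists u, represents f u.
Proof. by exists (fun n => filt_val (lrepr (f n))) => n; exact: grp_rep. Qed.

Lemma represents_inj f g u v :
  represents f u -> represents g v -> u =1 v -> f = g.
Proof.
by move=> fu gv uv; apply: dsumP => n; rewrite (fu n).2 (gv n).2 uv.
Qed.

Lemma represents_lin a f g u v : represents f u -> represents g v ->
  represents (a *: f + g) (fun n => a *: u n + v n).
Proof.
move=> fu gv n; have [Fu fE] := fu n; have [Fv gE] := gv n; split.
  by rewrite rpredD ?rpredZ.
by rewrite dsumDE dsumZE fE gE grp_clsP.
Qed.

Lemma represents_mul f g u v : represents f u -> represents g v ->
  represents (gr_mul f g) (conv u v).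
Proof.
move=> fu gv n.
have F (k : 'I_n.+1) : rb_mul U (u k) (v (n - k)%N) \in filt n.
  by have := filt_mul (fu k).1 (gv (n - k)%N).1; rewrite subnKC ?leq_ord.
split; first by rewrite rpred_sum.
rewrite /conv grp_cls_sum //; apply: eq_bigr => k _.
by rewrite (fu _).2 (gv _).2 grp_mulE ?(fu _).1 ?(gv _).1.
Qed.

Lemma represents_op f u :
  represents f u -> represents (gr_op f) (fun n => rb_op U (u n)).
Proof.
by move=> fu n; have [Fu fE] := fu n; rewrite filt_op //= fE grp_opE.
Qed.

Fact gr_mulA : associative gr_mul.
Proof.
move=> f g h; have [u fu] := represents_ex f; have [v gv] := represents_ex g.
have [w hw] := represents_ex h.
apply: (represents_inj (represents_mul fu (represents_mul gv hw))
  (represents_mul (represents_mul fu gv) hw)).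
exact: convA.
Qed.

Fact gr_mulC : commutative gr_mul.
Proof.
move=> f g; have [u fu] := represents_ex f; have [v gv] := represents_ex g.
exact: represents_inj (represents_mul fu gv) (represents_mul gv fu) (convC u v).
Qed.

Fact gr_mulPl a f f' g : gr_mul (a *: f + f') g = a *: gr_mul f g + gr_mul f' g.
Proof.
have [u fu] := represents_ex f; have [u' fu'] := represents_ex f'.
have [v gv] := represents_ex g.
apply: (represents_inj (represents_mul (represents_lin a fu fu') gv)
  (represents_lin a (represents_mul fu gv) (represents_mul fu' gv))).
exact: convP.
Qed.

Fact gr_mul_bilinear : bilinear_for *:%R *:%R gr_mul.
Proof.
split=> [g a f f'|g a f f']; first exact: gr_mulPl.
by rewrite ![gr_mul g _]gr_mulC gr_mulPl.
Qed.

HB.instance Definition _ := bilinear_isBilinear.Build K (dsum grp) (dsum grp)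
  (dsum grp) *:%R *:%R gr_mul gr_mul_bilinear.

Fact gr_op_linear : linear gr_op.
Proof.
move=> a f g; have [u fu] := represents_ex f; have [v gv] := represents_ex g.
apply: (represents_inj (represents_op (represents_lin a fu gv))
  (represents_lin a (represents_op fu) (represents_op gv))).
by move=> n; rewrite linearP.
Qed.

HB.instance Definition _ :=
  GRing.isLinear.Build K (dsum grp) (dsum grp) *:%R gr_op gr_op_linear.

Fact gr_opP f g : gr_mul (gr_op f) (gr_op g) =
  gr_op (gr_mul (gr_op f) g + gr_mul f (gr_op g) + lam *: gr_mul f g).
Proof.
have [u fu] := represents_ex f; have [v gv] := represents_ex g.
have fRu := represents_op fu; have gRv := represents_op gv.
rewrite addrC -[X in _ + (X + _)]scale1r.
apply: (represents_inj (represents_mul fRu gRv) (represents_op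
  (represents_lin lam (represents_mul fu gv) (represents_lin 1
    (represents_mul fRu gv) (represents_mul fu gRv))))).
move=> n; rewrite scale1r addrC /conv scaler_sumr -!big_split linear_sum.
by apply: eq_bigr => k _; rewrite rb_opP.
Qed.

(* The degree-n component of [gr] is [filt n] / [filt n.-1]; since [filt 0] is
   zero, the degree-0 component vanishes. *)
Definition gr : rbComAlg lam := RBComAlg gr_mulA gr_mulC gr_opP.

End Graded.

Definition rbCom_postCom_PBW_pair (K : fieldType) (lam : K) (lam0 : lam != 0) : Prop :=
  forall (A : postCom K) (U : rbComAlg lam) (i : {linear A -> U})
    (V : rbComAlg lam) (j : {linear Ab A -> V}),
    is_universal_enveloping lam0 i -> is_universal_enveloping lam0 j ->
    rb_isomorphic (gr i) V.

(* Main.v *)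
Require Import Defs.
From HB Require Import structures.
From mathcomp Require Import all_boot all_algebra.
From mathcomp Require Import finmap ring boolp classical_sets.
From mathcomp.multinomials Require Import monalg.

(* Write R for the operator divided by lam, so that R has weight 1, and
   x o y = x > y + y > x + x _|_ y. Any Rota-Baxter algebra generated by a
   homomorphic image of A is spanned by the elements a, a R(p) and p, where a
   runs over A and p over the iterated words built from R(a) by p |-> R(p) and
   p |-> R(a) R(p). The same words span U(Ab A), so the canonical surjection
   from U(Ab A) to gr U(A) is bijective as soon as the words over a basis of A
   are linearly independent in U(A), compatibly with the filtration.
   This is read off a model: let H = K + (A, o), let D = T(H) be the
   quasi-shuffle algebra of H, and let E = H + A, where H acts on A by >. On
   E (x) D there is a unique Rota-Baxter operator such that
   R(h (x) d) = 1 (x) hd for h in H, R(a (x) 1) = a' (x) 1 with a' the copy of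
   a in H, and R(a R(p)) = R(a) R(p) - R(R(a) p) - R(a p). It sends distinct
   words to distinct basis vectors. *)

Set Implicit Arguments.
Unset Strict Implicit.
Unset Printing Implicit Defensive.

Import GRing.Theory.
Local Open Scope ring_scope.

(** * Free modules *)

Section LinearExtension.
Variables (K : fieldType) (X : choiceType).
Implicit Type g : {malg K[X]}.

Lemma malg_lin_ind (P : {malg K[X]} -> Prop) :
  P 0 -> (forall a g h, P g -> P h -> P (a *: g + h)) ->
  (forall x, P << x >>) -> forall g, P g.
Proof.
move=> P0 Pl PU g; rewrite [g]monalgE.
elim/big_rec: _ => // x h _ Ph.
suff -> : << g@_x *g x >> = g@_x *: << x >> by apply: Pl.
by apply/malgP=> y; rewrite mcoeffZ !mcoeffU mulr_natr.
Qed.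

Definition lext_fun (Z : lmodType K) (F : X -> Z) g : Z :=
  \sum_(x <- msupp g) g@_x *: F x.

Lemma lext_fun_sub (Z : lmodType K) (F : X -> Z) (d : {fset X}) g :
  (msupp g `<=` d)%fset -> lext_fun F g = \sum_(x <- d) g@_x *: F x.
Proof.
move=> gd; rewrite /lext_fun (big_fset_incl _ gd) // => x _.
by move=> /mcoeff_outdom ->; rewrite scale0r.
Qed.

Fact lext_linear (Z : lmodType K) (F : X -> Z) : linear (lext_fun F).
Proof.
move=> a g h; pose d := (msupp g `|` msupp h `|` msupp (a *: g + h))%fset.
rewrite !(@lext_fun_sub Z F d) /d ?fsubsetUr //; last first.
- by rewrite -fsetUA fsubsetUl.
- by rewrite fsetUAC fsubsetUr.
rewrite scaler_sumr -big_split; apply: eq_bigr => x _ /=.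
by rewrite mcoeffD mcoeffZ scalerDl scalerA.
Qed.

HB.instance Definition _ (Z : lmodType K) (F : X -> Z) :=
  GRing.isLinear.Build K {malg K[X]} Z *:%R (lext_fun F) (lext_linear F).

Definition lext (Z : lmodType K) (F : X -> Z) : {linear {malg K[X]} -> Z} :=
  lext_fun F.

Lemma lextU (Z : lmodType K) (F : X -> Z) x : lext F << x >> = F x.
Proof.
rewrite /lext /= /lext_fun msuppU oner_eq0 big_seq_fset1 mcoeffUU.
by rewrite scale1r.
Qed.

End LinearExtension.

(** * Existence of bases of vector spaces *)

Section HamelBasis.
Variables (K : fieldType) (A : lmodType K).
Local Open Scope classical_set_scope.

Definition lin_indep (S : set A) : Prop :=
  forall (s : seq A) (c : A -> K), uniq s -> (forall x, x \in s -> S x) ->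
    \sum_(x <- s) c x *: x = 0 -> forall x, x \in s -> c x = 0.

(** A finite list of vectors from the union of a chain already lies in one member of the chain. *)
Lemma lin_indep_chain (F : set (set A)) :
  F `<=` lin_indep -> total_on F subset -> lin_indep (\bigcup_(S in F) S).
Proof.
(* The empty list is set apart because [F] may be empty. *)
move=> Fi Ft s c us sF; suff [->//|[S FS sS]] : s = [::] \/ exists2 S, F S &
    forall x, x \in s -> S x by exact: (Fi S).
elim: s sF {us} => [|x s IH] sF; [by left | right].
have [T FT Tx] := sF x (mem_head _ _).
have [->|[S FS sS]] := IH (fun y ys => sF y (mem_behead (s := x :: s) ys)).
  by exists T => // y; rewrite inE => /eqP ->.
have [ST|TS] := Ft S T FS FT.
  by exists T => // y; rewrite inE => /predU1P[->//|/sS/ST].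
by exists S => // y; rewrite inE => /predU1P[->|/sS//]; exact: TS.
Qed.

(** The index type is a maximal independent set given by Zorn's lemma. The coordinate map inverts
    the bijective linear extension of the inclusion, which makes it linear. *)
Lemma hamel_basis : exists (X : choiceType) (b : X -> A)
  (crd : {linear A -> {malg K[X]}}),
  (forall x, crd (b x) = << x >>%R) /\ (forall a, lext b (crd a) = a).
Proof.
have [S [Si Smax]] := Zorn_bigcup lin_indep_chain.
pose X : choiceType := {x : A | `[< S x >]}; pose b (x : X) : A := val x.
have b_inj g : lext b g = 0 -> g = 0.
  pose c a := if insub a is Some x then g@_(x : X) else 0.
  have cb x : c (b x) = g@_x by rewrite /c valK.
  rewrite /lext /= /lext_fun => g0; apply/malgP => x; rewrite mcoeff0.
  case: msuppP => // xg; rewrite -cb.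
  apply: (Si [seq b x | x <- msupp g] c).
  - by rewrite map_inj_uniq ?fset_uniq //; exact: val_inj.
  - by move=> _ /mapP[[y Sy] _ ->]; exact/asboolP.
  - by rewrite big_map -[RHS]g0; apply: eq_bigr => y _; rewrite cb.
  - exact: map_f.
have b_surj a : exists g, lext b g = a.
  (* Adding a vector outside the span would keep the set independent, against maximality. *)
  apply: contrapT => na; apply: (Smax (S `|` [set a])).
    split; first by left.
    move=> /(_ a (or_intror erefl)) Sa; apply: na.
    by exists << Sub a (asboolT Sa) : X >>; rewrite lextU.
  have spanS (s : seq A) (c : A -> K) : (forall x, x \in s -> S x) ->
      exists g, lext b g = \sum_(x <- s) c x *: x.
    elim: s => [|x s IH] sS; first by exists 0; rewrite linear0 big_nil.
    have [|g gE] := IH; first by move=> y ys; apply: sS; rewrite inE ys orbT.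
    exists (c x *: << Sub x (asboolT (sS x (mem_head _ _))) : X >> + g).
    by rewrite linearP gE big_cons lextU.
  move=> s c us sSa s0 x.
  have [sa|sa] := boolP (a \in s); last first.
    have sS y : y \in s -> S y.
      by move=> ys; have [//|ya] := sSa y ys; rewrite -ya ys in sa.
    exact: Si us sS s0 x.
  have srS y : y \in rem a s -> S y.
    by rewrite mem_rem_uniq // inE => /andP[/eqP ya /sSa[]].
  have s0' : c a *: a + \sum_(y <- rem a s) c y *: y = 0.
    by rewrite -[RHS]s0 [in RHS](perm_big _ (perm_to_rem sa)) /= big_cons.
  (* Otherwise [a] could be expressed through the other vectors of the list, which lie in [S]. *)
  have ca : c a = 0.
    apply: contrapT => /eqP ca; apply: na.
    have [g gE] := spanS _ c srS; exists (- (c a)^-1 *: g).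
    rewrite linearZ_LR gE; move/eqP: s0'; rewrite addrC addr_eq0 => /eqP ->.
    by rewrite scalerN scaleNr opprK scalerA mulVf ?scale1r.
  have [->//|xa] := eqVneq x a => xs.
  apply: (Si (rem a s) c); rewrite ?rem_uniq ?mem_rem_uniq ?inE ?xa //.
  by move: s0'; rewrite ca scale0r add0r.
have [crd crdK] : exists crd : A -> {malg K[X]}, forall a, lext b (crd a) = a.
  exists (fun a => xget 0 [set g | lext b g = a]) => a; case: xgetP => // ng.
  by have [g gE] := b_surj a; case: (ng g).
have b_eq g h : lext b g = lext b h -> g = h.
  move=> gh; apply/eqP; rewrite -subr_eq0; apply/eqP/b_inj.
  by rewrite linearB gh subrr.
have crd_lin : linear crd.
  by move=> a x y; apply: b_eq; rewrite linearP !crdK.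
pose crdL : {linear A -> {malg K[X]}} :=
  HB.pack crd (GRing.isLinear.Build K A {malg K[X]} *:%R crd crd_lin).
exists X, b, crdL; split=> [x|//]; apply: b_eq.
by rewrite crdK lextU.
Qed.

End HamelBasis.

(** * Normal forms in an enveloping algebra *)

Section NormalForms.
Variables (K : fieldType) (lam : K) (lam0 : lam != 0).
Variables (A : postCom K) (B : rbComAlg lam) (f : {linear A -> B}).
Hypothesis f_hom : is_pc_hom (B := psi lam0 B) f.

Local Notation "x ** y" := (rb_mul B x y) (at level 40, left associativity).
Local Notation "x >- y" := (pc_succ A x y) (at level 40, left associativity).
Local Notation "x _|_ y" := (pc_perp A x y) (at level 40, left associativity).

(** Dividing by [lam] gives weight 1 and turns the first product of [psi] into [rb1 x ** y]. *)
Definition rb1 (x : B) : B := lam^-1 *: rb_op B x.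

Fact rb1_linear : linear rb1.
Proof. by move=> c x y; rewrite /rb1 linearP scalerDr !scalerA mulrC. Qed.

HB.instance Definition _ := GRing.isLinear.Build K B B *:%R rb1 rb1_linear.

Lemma rb1P x y : rb1 x ** rb1 y = rb1 (rb1 x ** y + x ** rb1 y + x ** y).
Proof.
rewrite /rb1 linearZl_LR linearZr_LR rb_opP; congr (_ *: _).
rewrite -linearZ_LR !scalerDr scalerA mulVf // scale1r.
by rewrite linearZl_LR linearZr_LR.
Qed.

Lemma f_succ x y : f (x >- y) = rb1 (f x) ** f y.
Proof. by have [-> _] := f_hom; rewrite /rb1 linearZl_LR. Qed.

Lemma f_perp x y : f (x _|_ y) = f x ** f y.
Proof. by have [_ ->] := f_hom. Qed.

(** The witness is x o y. The elements R(a) are thus closed under products, so a word needs at most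
    one factor R(a) at each level. *)
Lemma rb1_f x y : exists z, rb1 (f x) ** rb1 (f y) = rb1 (f z).
Proof.
exists (x >- y + y >- x + x _|_ y); rewrite rb1P !linearD !f_succ f_perp.
by rewrite (rb_mulC (f x)).
Qed.

(* If B0 is the subalgebra generated by the image of A, then [nf_span] is B0
   and [op_span] is R(B0). *)
Inductive op_span : B -> Prop :=
| op_span0 : op_span 0
| op_span_lin c x y : op_span x -> op_span y -> op_span (c *: x + y)
| op_span_gen a : op_span (rb1 (f a))
| op_span_op x : op_span x -> op_span (rb1 x)
| op_span_gen_op a x : op_span x -> op_span (rb1 (f a) ** rb1 x).

Inductive nf_span : B -> Prop :=
| nf_span0 : nf_span 0
| nf_span_lin c x y : nf_span x -> nf_span y -> nf_span (c *: x + y)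
| nf_span_gen a : nf_span (f a)
| nf_span_gen_op a x : op_span x -> nf_span (f a ** rb1 x)
| nf_span_P x : op_span x -> nf_span x.

Lemma op_spanD x y : op_span x -> op_span y -> op_span (x + y).
Proof. by rewrite -{2}[x]scale1r; exact: op_span_lin. Qed.

Lemma nf_spanD x y : nf_span x -> nf_span y -> nf_span (x + y).
Proof. by rewrite -{2}[x]scale1r; exact: nf_span_lin. Qed.

Lemma op_span_mul_gen a x : op_span x -> op_span (rb1 (f a) ** x).
Proof.
elim=> [|c y z _ Py _ Pz|b|y Py _|b y Py _].
- by rewrite linear0r; exact: op_span0.
- by rewrite linearPr; apply: op_span_lin.
- by have [c ->] := rb1_f a b; exact: op_span_gen.
- exact: op_span_gen_op.
- by rewrite rb_mulA; have [c ->] := rb1_f a b; exact: op_span_gen_op.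
Qed.

(** The hypothesis on [x] is the outer induction hypothesis of [op_span_mul]; the inner induction is
    on [y]. The Rota-Baxter identity turns R(x) R(z) into R of three products, each covered by one
    of the two. *)
Lemma op_span_mul_op x y :
  op_span x -> (forall z, op_span z -> op_span (x ** z)) -> op_span y ->
  op_span (rb1 x ** y).
Proof.
move=> Px xP; have mul_op z : op_span z -> op_span (rb1 x ** z) ->
    op_span (rb1 x ** rb1 z).
  move=> Pz Pxz; rewrite rb1P; apply/op_span_op/op_spanD; last exact: xP.
  by apply: op_spanD => //; apply/xP/op_span_op.
elim=> [|c z t _ Pz _ Pt|a|z Pz IH|a z Pz IH].
- by rewrite linear0r; exact: op_span0.
- by rewrite linearPr; apply: op_span_lin.
- by rewrite rb_mulC; exact: op_span_gen_op.
- exact: mul_op.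
rewrite rb_mulA (rb_mulC (rb1 x)) -rb_mulA; exact/op_span_mul_gen/mul_op.
Qed.

Lemma op_span_mul x y : op_span x -> op_span y -> op_span (x ** y).
Proof.
move=> Px; elim: Px y => [|c z t _ Pz _ Pt|a|z Pz IH|a z Pz IH] y Py.
- by rewrite linear0l; exact: op_span0.
- by rewrite linearPl; apply: op_span_lin; [apply: Pz | apply: Pt].
- exact: op_span_mul_gen.
- exact: op_span_mul_op.
- by rewrite -rb_mulA; apply/op_span_mul_gen/op_span_mul_op.
Qed.

Lemma f_rb1 a c : f a ** rb1 (f c) = f (c >- a).
Proof. by rewrite f_succ rb_mulC. Qed.

Lemma nf_span_gen_P a x : op_span x -> nf_span (f a ** x).
Proof.
elim=> [|c y z _ Ny _ Nz|b|y Py _|b y Py _].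
- by rewrite linear0r; exact: nf_span0.
- by rewrite linearPr; apply: nf_span_lin.
- by rewrite f_rb1; exact: nf_span_gen.
- exact: nf_span_gen_op.
- by rewrite rb_mulA f_rb1; exact: nf_span_gen_op.
Qed.

Lemma nf_span_gen_mul a x : nf_span x -> nf_span (f a ** x).
Proof.
elim=> [|c y z _ Ny _ Nz|b|b y Py|y Py]; last exact: nf_span_gen_P.
- by rewrite linear0r; exact: nf_span0.
- by rewrite linearPr; apply: nf_span_lin.
- by rewrite -f_perp; exact: nf_span_gen.
- by rewrite rb_mulA -f_perp; exact: nf_span_gen_op.
Qed.

Lemma nf_span_P_mul x y : op_span x -> nf_span y -> nf_span (x ** y).
Proof.
move=> Px; elim=> [|c z t _ Nz _ Nt|b|b z Pz|z Pz].
- by rewrite linear0r; exact: nf_span0.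
- by rewrite linearPr; apply: nf_span_lin.
- by rewrite rb_mulC; exact: nf_span_gen_P.
- rewrite rb_mulA (rb_mulC x) -rb_mulA; apply/nf_span_gen_P/op_span_mul => //.
  exact: op_span_op.
- exact/nf_span_P/op_span_mul.
Qed.

Lemma nf_span_mul x y : nf_span x -> nf_span y -> nf_span (x ** y).
Proof.
move=> Nx Ny; elim: Nx => [|c z t _ Nz _ Nt|b|b z Pz|z Pz].
- by rewrite linear0l; exact: nf_span0.
- by rewrite linearPl; apply: nf_span_lin.
- exact: nf_span_gen_mul.
- by rewrite -rb_mulA; apply/nf_span_gen_mul/nf_span_P_mul => //; exact: op_span_op.
- exact: nf_span_P_mul.
Qed.

Lemma op_spanB x y : op_span x -> op_span y -> op_span (x - y).
Proof. by move=> Px Py; rewrite addrC -scaleN1r; exact: op_span_lin. Qed.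

(** The Rota-Baxter identity for [f a] and [x], solved for R(a R(x)). *)
Lemma op_span_rb1_step a x :
  op_span x -> op_span (rb1 (f a ** x)) -> op_span (rb1 (f a ** rb1 x)).
Proof.
move=> Px Pax; have -> : rb1 (f a ** rb1 x) =
    rb1 (f a) ** rb1 x - rb1 (rb1 (f a) ** x) - rb1 (f a ** x).
  by rewrite rb1P !linearD addrAC addrK addrAC subrr add0r.
apply: op_spanB => //; apply: op_spanB; first exact: op_span_gen_op.
exact/op_span_op/op_span_mul_gen.
Qed.

(** The induction keeps [a] general, because a R(b) is the element b > a of A and so replaces the
    generator. *)
Lemma op_span_rb1_gen_op a x : op_span x -> op_span (rb1 (f a ** rb1 x)).
Proof.
move=> Px; elim: Px a => [|c y z _ Py _ Pz|b|y Py IH|b y Py IH] a.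
- by rewrite !(linear0, linear0r); exact: op_span0.
- by rewrite linearP linearPr linearP; apply: op_span_lin; [apply: Py | apply: Pz].
- by apply: op_span_rb1_step; [|rewrite f_rb1]; exact: op_span_gen.
- by apply: op_span_rb1_step; [exact: op_span_op | exact: IH].
apply: op_span_rb1_step; first exact: op_span_gen_op.
by rewrite rb_mulA f_rb1; exact: IH.
Qed.

Lemma nf_span_rb1 x : nf_span x -> op_span (rb1 x).
Proof.
elim=> [|c y z _ Py _ Pz|b|b y Py|y Py].
- by rewrite linear0; exact: op_span0.
- by rewrite linearP; apply: op_span_lin.
- exact: op_span_gen.
- exact: op_span_rb1_gen_op.
- exact: op_span_op.
Qed.

(** * Words over a basis of A *)

Section Words.
Variables (X : choiceType) (b : X -> A) (crd : A -> {malg K[X]}).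
Hypothesis b_crd : forall a, lext b (crd a) = a.

(* In (s, x), the list s is applied to R(x) from the right: [None] stands for
   p |-> R(p) and [Some y] for p |-> R(y) R(p). *)
Definition eval_op (p : seq (option X) * X) : B :=
  foldr (fun t v => if t is Some x then rb1 (f (b x)) ** rb1 v else rb1 v)
    (rb1 (f (b p.2))) p.1.

Lemma eval_op_some y s x : eval_op (Some y :: s, x) =
  rb1 (f (b y)) ** rb1 (eval_op (s, x)).
Proof. by []. Qed.

Lemma eval_op_none s x : eval_op (None :: s, x) = rb1 (eval_op (s, x)).
Proof. by []. Qed.

Definition word : choiceType :=
  ((seq (option X) * X) + (X * option (seq (option X) * X)))%type.

Definition eval_word (q : word) : B :=
  match q with
  | inl p => eval_op p
  | inr (x, None) => f (b x)
  | inr (x, Some p) => f (b x) ** rb1 (eval_op p)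
  end.

Lemma eval_word_some x p : eval_word (inr (x, Some p)) = f (b x) ** rb1 (eval_op p).
Proof. by []. Qed.

Definition in_range (Y : choiceType) (F : Y -> B) (x : B) : Prop :=
  exists g, x = lext F g.

Lemma in_range_lin (Y : choiceType) (F : Y -> B) c x y :
  in_range F x -> in_range F y -> in_range F (c *: x + y).
Proof. by move=> [g ->] [h ->]; exists (c *: g + h); rewrite linearP. Qed.

Lemma in_range0 (Y : choiceType) (F : Y -> B) : in_range F 0.
Proof. by exists 0; rewrite linear0. Qed.

Lemma in_range_gen (Y : choiceType) (F : Y -> B) y : in_range F (F y).
Proof. by exists << y >>; rewrite lextU. Qed.

Lemma in_range_map (Y Z : choiceType) (E : lmodType K) (F : Y -> B) (G : Z -> E)
    (h : {linear E -> B}) (g : {malg K[Z]}) :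
  (forall z, in_range F (h (G z))) -> in_range F (h (lext G g)).
Proof.
move=> hG; elim/malg_lin_ind: g => [|c g g' IH IH'|z].
- by rewrite !linear0; exact: in_range0.
- by rewrite !linearP; exact: in_range_lin.
- by rewrite lextU.
Qed.

Lemma op_span_range x : op_span x -> in_range eval_op x.
Proof.
elim=> [|c y z _ Ry _ Rz|a|y _ [g ->]|a y _ [g ->]].
- exact: in_range0.
- exact: in_range_lin.
- rewrite -(b_crd a); apply: (in_range_map (h := rb1 \o f)) => y.
  exact: (in_range_gen eval_op ([::], y)).
- apply: in_range_map => -[s z].
  exact: (in_range_gen eval_op (None :: s, z)).
(* Commutativity puts the factor to be expanded last, where the product is a linear map; the two
   factors are expanded one after the other. *)
- rewrite -(b_crd a) rb_mulC.
  apply: (in_range_map (h := rb_mul B (rb1 (lext eval_op g)) \o (rb1 \o f))) => x'.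
  rewrite /= rb_mulC.
  apply: (in_range_map (h := rb_mul B (rb1 (f (b x'))) \o rb1)) => -[s z].
  exact: (in_range_gen eval_op (Some x' :: s, z)).
Qed.

Lemma nf_span_range x : nf_span x -> in_range eval_word x.
Proof.
elim=> [|c y z _ Ry _ Rz|a|a y /op_span_range[g ->]|y /op_span_range[g ->]].
- exact: in_range0.
- exact: in_range_lin.
- rewrite -(b_crd a); apply: in_range_map => y.
  exact: (in_range_gen eval_word (inr (y, None))).
- rewrite -(b_crd a) rb_mulC.
  apply: (in_range_map (h := rb_mul B (rb1 (lext eval_op g)) \o f)) => x'.
  rewrite /= rb_mulC.
  apply: (in_range_map (h := rb_mul B (f (b x')) \o rb1)) => p.
  exact: (in_range_gen eval_word (inr (x', Some p))).
- apply: (in_range_map (h := idfun)) => p.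
  exact: (in_range_gen eval_word (inl p)).
Qed.

End Words.

End NormalForms.

Lemma eval_word_hom (K : fieldType) (lam : K) (A A' : postCom K)
    (B C : rbComAlg lam) (f : {linear A -> B}) (f' : {linear A' -> C})
    (X : choiceType) (b : X -> A) (b' : X -> A') (g : {linear B -> C}) :
  is_rb_hom g -> (forall x, g (f (b x)) = f' (b' x)) ->
  forall q, g (eval_word f b q) = eval_word f' b' q.
Proof.
move=> [gM gR] gf; have g1 x : g (rb1 x) = rb1 (g x) by rewrite linearZ gR.
have gP p : g (eval_op f b p) = eval_op f' b' p.
  case: p => s y; rewrite /eval_op /=.
  by elim: s => [|[x|] s IH] /=; rewrite ?gM !g1 ?gf ?IH.
by case=> [p|[x [p|]]] /=; rewrite ?gM ?g1 ?gf ?gP.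
Qed.

(** The universal property makes every element of [U] the value of a term, and the span of normal
    forms is closed under all operations of terms. *)
Lemma enveloping_nf_span (K : fieldType) (lam : K) (lam0 : lam != 0) (A : postCom K)
    (U : rbComAlg lam) (i : {linear A -> U}) :
  is_universal_enveloping lam0 i -> forall x, nf_span i x.
Proof.
move=> [i_hom univ] x.
have [g [g_hom gi _]] := univ _ _ (env_universal lam0 A).1.
have [k [_ _ k_uniq]] := univ _ _ i_hom.
(* Both the identity and the passage through the term algebra extend [i], so uniqueness makes them
   equal. *)
have -> : x = env_lift i (g x).
  have hid : is_rb_hom (idfun : {linear U -> U}) by [].
  rewrite -[LHS]/((idfun : {linear U -> U}) x) (k_uniq _ hid) //.
  have [lM lR] := env_lift_hom i_hom; have [gM gR] := g_hom.
  have hcomp : is_rb_hom (env_lift_lin i_hom \o g).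
    by split=> [y z|y] /=; rewrite ?gM ?gR [LHS](lM, lR).
  rewrite -(k_uniq _ hcomp) // => a /=; rewrite gi.
  exact: env_liftE.
have [s ->] := env_surj (g x); rewrite env_liftE //.
have NZ c y : nf_span i y -> nf_span i (c *: y).
  by move=> Ny; rewrite -[_ *: _]addr0; apply/nf_span_lin/nf_span0.
elim: s => [a||s Ns t Nt|s Ns|c s Ns|s Ns t Nt|s Ns] /=.
- exact: nf_span_gen.
- exact: nf_span0.
- exact: nf_spanD.
- by rewrite -scaleN1r; apply: NZ.
- exact: NZ.
- exact: (nf_span_mul i_hom).
- rewrite -[rb_op U _]scale1r -(mulfV lam0) -scalerA; apply/NZ/nf_span_P.
  exact: (nf_span_rb1 i_hom).
Qed.

(** * Homogeneous elements of the associated graded algebra *)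

Section SingleDegree.
Variables (K : fieldType) (lam : K) (U : rbComAlg lam) (X : Type) (i : X -> U).

Fact sing_fin n (u : U) : exists N, forall m, (N <= m)%N ->
  grp_cls i m (if m == n then u else 0) = 0.
Proof. by exists n.+1 => m nm; rewrite gtn_eqF // grp_cls0. Qed.

(** The homogeneous element of degree [n] with symbol [u]. It is meaningful for [u] in [filt i n]
    only, since [grp_cls] sends other vectors to zero. *)
Definition sing n u : gr i := DSum (sing_fin n u).

Lemma represents_sing n u : u \in filt i n ->
  represents (sing n u : dsum (grp i)) (fun m => if m == n then u else 0).
Proof. by move=> un m; split=> //; case: eqP => [->|]; rewrite ?rpred0. Qed.

Lemma singP n c u v : u \in filt i n -> v \in filt i n ->
  sing n (c *: u + v) = c *: sing n u + sing n v.
Proof.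
move=> un vn; have uvn : c *: u + v \in filt i n by rewrite rpredD ?rpredZ.
apply: (represents_inj (represents_sing uvn)
  (represents_lin c (represents_sing un) (represents_sing vn))) => m.
by case: eqP => // _; rewrite scaler0 addr0.
Qed.

Lemma sing0 n : sing n 0 = 0.
Proof.
have := singP (-1) (rpred0 (filt i n)) (rpred0 _).
by rewrite scaler0 addr0 scaleN1r addNr.
Qed.

Lemma singZ n c u : u \in filt i n -> sing n (c *: u) = c *: sing n u.
Proof.
by move=> un; rewrite -[_ *: u]addr0 singP ?rpred0 // sing0 addr0.
Qed.

Lemma sing_lower n u : u \in filt i n -> sing n.+1 u = 0.
Proof.
move=> un; apply: dsumP => m; rewrite [LHS]/=.
case: eqP => [->|_]; last exact: grp_cls0.
rewrite -[RHS](grp_cls0 i); apply/grp_cls_eq; rewrite ?rpred0 ?subr0 //.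
exact: filtW un.
Qed.

Lemma sing_mul m n u v : u \in filt i m -> v \in filt i n ->
  rb_mul (gr i) (sing m u) (sing n v) = sing (m + n)%N (rb_mul U u v).
Proof.
move=> um vn; apply: (represents_inj
  (represents_mul (represents_sing um) (represents_sing vn))
  (represents_sing (filt_mul um vn))) => k; rewrite /conv.
have [->|kmn] := eqVneq k (m + n)%N.
  have mk : (m < (m + n).+1)%N by rewrite ltnS leq_addr.
  rewrite (bigD1 (Ordinal mk)) //= eqxx addKn eqxx big1 ?addr0 // => j jm.
  by rewrite ifN ?linear0l.
apply: big1 => j _; case: eqP => [jm|_]; last by rewrite linear0l.
case: eqP => [jn|_]; last by rewrite linear0r.
by case/eqP: kmn; rewrite -jm -jn subnKC // leq_ord.
Qed.

Lemma sing_op n u : u \in filt i n -> rb_op (gr i) (sing n u) = sing n (rb_op U u).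
Proof.
move=> un; apply: (represents_inj (represents_op (represents_sing un))
  (represents_sing (filt_op un))) => m.
by case: eqP => // _; rewrite linear0.
Qed.

End SingleDegree.

(** * A model with independent normal forms *)

Lemma scalerDD (R : pzRingType) (V : lmodType R) (a : R) (x y x' y' : V) :
  (a *: x + y) + (a *: x' + y') = a *: (x + x') + (y + y').
Proof. by rewrite scalerDr addrACA. Qed.

Lemma scalerBBD (R : pzRingType) (V : lmodType R) (a : R) (x y z x' y' z' : V) :
  (a *: x + x') - (a *: y + y') - (a *: z + z') =
  a *: (x - y - z) + (x' - y' - z').
Proof. by rewrite !scalerBr !opprD !addrA (ACl (1*3*5*2*4*6)). Qed.

Lemma eq_lext (K : fieldType) (X : choiceType) (Z : lmodType K)
    (F G : X -> Z) g : F =1 G -> lext F g = lext G g.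
Proof. by move=> FG; apply: eq_bigr => x _; rewrite FG. Qed.

Lemma lext_linl (K : fieldType) (X : choiceType) (Z : lmodType K) a
    (F G : X -> Z) g :
  lext (fun x => a *: F x + G x) g = a *: lext F g + lext G g.
Proof.
rewrite /lext /= /lext_fun scaler_sumr -big_split; apply: eq_bigr => x _ /=.
by rewrite scalerDr !scalerA mulrC.
Qed.

(** Regrouping by leading letter for [dmulA]: here the terms led by the letter of the first factor
    are brought together, and in [addr9r] those led by the letter of the third. *)
Lemma addr9l (V : zmodType) (x1 x2 x3 x4 x5 x6 x7 x8 x9 : V) :
  x1 + x2 + x3 + (x4 + x5 + x6) + (x7 + x8 + x9) =
  x1 + x4 + x7 + x5 + x2 + x3 + x6 + x8 + x9.
Proof. by rewrite !addrA [LHS](ACl (1*4*7*5*2*3*6*8*9)). Qed.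

Lemma addr9r (V : zmodType) (x1 x2 x3 x4 x5 x6 x7 x8 x9 : V) :
  x1 + x2 + x3 + (x4 + x5 + x6) + (x7 + x8 + x9) =
  x1 + (x2 + x5 + x8) + x4 + x7 + x3 + x6 + x9.
Proof. by rewrite !addrA [LHS](ACl (1*2*5*8*4*7*3*6*9)). Qed.

(** * Degree bounds in a free module with graded basis *)

Section Degree.
Variables (K : fieldType) (X : choiceType) (deg : X -> nat).
Implicit Type g : {malg K[X]}.

Definition deg_le n g : Prop := forall x, (n < deg x)%N -> g@_x = 0.

Lemma deg_le0 n : deg_le n 0. Proof. by move=> x _; rewrite mcoeff0. Qed.

Lemma deg_leP n c g h : deg_le n g -> deg_le n h -> deg_le n (c *: g + h).
Proof.
by move=> gn hn x nx; rewrite mcoeffD mcoeffZ gn // hn // mulr0 addr0.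
Qed.

Lemma deg_leZ n c g : deg_le n g -> deg_le n (c *: g).
Proof. by move=> gn; rewrite -[_ *: _]addr0; apply/deg_leP/deg_le0. Qed.

Lemma deg_leD n g h : deg_le n g -> deg_le n h -> deg_le n (g + h).
Proof. by move=> gn; rewrite -[g]scale1r; apply: deg_leP. Qed.

Lemma deg_leB n g h : deg_le n g -> deg_le n h -> deg_le n (g - h).
Proof. by move=> gn hn; rewrite addrC -scaleN1r; apply: deg_leP. Qed.

Lemma deg_leW m n g : deg_le m g -> (m <= n)%N -> deg_le n g.
Proof. by move=> gm mn x nx; apply/gm/(leq_ltn_trans mn). Qed.

Lemma deg_leU n x : (deg x <= n)%N -> deg_le n << x >>.
Proof.
move=> xn y ny; rewrite mcoeffU; case: eqP => // xy.
by move: ny; rewrite -xy ltnNge xn.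
Qed.

End Degree.

Lemma deg_le_lext (K : fieldType) (X Y : choiceType) (deg : X -> nat)
    (deg' : Y -> nat) (F : X -> {malg K[Y]}) m n g :
  deg_le deg n g -> (forall x, (deg x <= n)%N -> deg_le deg' m (F x)) ->
  deg_le deg' m (lext F g).
Proof.
move=> gn Fm; rewrite /lext /= /lext_fun big_seq.
elim/big_rec: _ => [|x h xg hm]; first exact: deg_le0.
apply: deg_leP => //; apply: Fm; rewrite leqNgt; apply/negP => /gn gx.
by move: xg; rewrite -mcoeff_neq0 gx eqxx.
Qed.

(** * Extending the Rota-Baxter identity from pair to pair *)

Section RBExtension.
Variables (M : comNzRingType) (R : M -> M).
Hypothesis RB : {morph R : x y / x - y >-> x - y}.

Definition star (x y : M) : M := R x * y + x * R y + x * y.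

(** The Rota-Baxter identity of weight 1 for one pair only, so that it can be carried over from
    simpler pairs. *)
Definition rb_pair (x y : M) : Prop := R x * R y = R (star x y).

Lemma rb_pairC x y : rb_pair x y -> rb_pair y x.
Proof. by rewrite /rb_pair mulrC => ->; congr (R _); rewrite /star; ring. Qed.

(** The identity for (a, p) determines R(a R(p)). Substituting this value and multiplying R(p) with
    R(z) first reduces both sides to R of ring expressions that agree. *)
Lemma rb_pair_mulR a p z : rb_pair a p -> rb_pair p z ->
    rb_pair (R a * p) z -> rb_pair (a * p) z -> rb_pair a (star p z) ->
  rb_pair (a * R p) z.
Proof.
move=> ap pz Rapz apz apz'.
have RaRp : R (a * R p) = R a * R p - R (R a * p) - R (a * p).
  by rewrite ap -!RB; congr (R _); rewrite /star; ring.
rewrite /rb_pair RaRp 2!mulrBl -mulrA pz apz' Rapz apz -!RB.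
congr (R _); rewrite /star RaRp -[R (_ + _)]pz; ring.
Qed.

(** A similar computation in the second factor, except that R(a) is multiplied with R(c) and not
    with R(q); the composite pair needed is then [star a c] with [q]. *)
Lemma rb_pair_mulR_swap a c q : rb_pair a c -> rb_pair c q ->
    rb_pair (star a c) q -> rb_pair a (R c * q) -> rb_pair a (c * q) ->
  rb_pair a (c * R q).
Proof.
move=> ac cq acq acq' acq''.
have RcRq : R (c * R q) = R c * R q - R (R c * q) - R (c * q).
  by rewrite cq -!RB; congr (R _); rewrite /star; ring.
rewrite /rb_pair RcRq 2!mulrBr mulrA ac acq acq' acq'' -!RB.
congr (R _); rewrite /star RcRq -[R (_ + _)]ac; ring.
Qed.

End RBExtension.

Section Model.
Variables (K : fieldType) (A : postCom K) (X : choiceType) (b : X -> A).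
Variable crd : {linear A -> {malg K[X]}}.
Hypothesis crd_b : forall x, crd (b x) = << x >>.
Hypothesis b_crd : forall a, lext b (crd a) = a.

Local Notation "x >- y" := (pc_succ A x y) (at level 40, left associativity).
Local Notation "x _|_ y" := (pc_perp A x y) (at level 40, left associativity).

Definition circ (x y : A) : A := x >- y + y >- x + x _|_ y.

Lemma circC x y : circ x y = circ y x.
Proof. by rewrite /circ [x >- y + _]addrC pc_perpC. Qed.

Lemma circPl a x x' y : circ (a *: x + x') y = a *: circ x y + circ x' y.
Proof. by rewrite /circ !(linearPl, linearPr) !scalerDD. Qed.

Lemma circ_succ x y z : circ x y >- z = x >- (y >- z).
Proof. exact: pc_succA. Qed.

Lemma succCA x y z : x >- (y >- z) = y >- (x >- z).
Proof. by rewrite -!circ_succ circC. Qed.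

Lemma perp_succ x y z : x _|_ (y >- z) = y >- (x _|_ z).
Proof. by rewrite -pc_perp_succ pc_succ_perp. Qed.

Lemma circA x y z : circ x (circ y z) = circ (circ x y) z.
Proof.
(* The expansion is symmetric in the three arguments up to [succCA] and the commutativity of
   [pc_perp]; with [circC] this gives associativity. *)
suff symm u v w : circ u (circ v w) = u >- (v >- w) + u >- (w >- v) + v >- (w >- u)
     + (u >- (v _|_ w) + v >- (u _|_ w) + w >- (u _|_ v)) + u _|_ v _|_ w.
  rewrite [RHS]circC !symm (succCA z x) (succCA z y).
  rewrite (pc_perpC z x) (pc_perpC z y); congr (_ + _ + _).
  - by rewrite (ACl (2*3*1)).
  - by rewrite (ACl (3*1*2)).
  - by rewrite -!pc_perpA (pc_perpC z y).
rewrite {1}/circ circ_succ /circ !linearDr /= !perp_succ pc_perpA.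
by rewrite !addrA (ACl (1*2*4*3*5*6*7)).
Qed.

(* The triple (k, x, a) stands for k + x' + a, where x' is the copy of x in H. *)
Definition E := (K^o * A * A)%type.
HB.instance Definition _ := GRing.Lmodule.on E.

Definition hat (a : A) : E := (0, a, 0).
Definition plain (a : A) : E := (0, 0, a).

Lemma plainP c a a' : plain (c *: a + a') = c *: plain a + plain a'.
Proof. by congr (_, _, _); rewrite /= ?scaler0 ?addr0. Qed.

Lemma hatP c a a' : hat (c *: a + a') = c *: hat a + hat a'.
Proof. by congr (_, _, _); rewrite /= ?scaler0 ?addr0. Qed.

Definition hact (e : E) (a : A) : A := e.1.1 *: a + e.1.2 >- a.

Fact mul_key : unit. Proof. exact: tt. Qed.

(* The products are locked: unification would otherwise unfold them down to
   the finitely supported functions. *)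
Definition emul : E -> E -> E := locked_with mul_key (fun e f =>
  (e.1.1 * f.1.1, e.1.1 *: f.1.2 + f.1.1 *: e.1.2 + circ e.1.2 f.1.2,
   hact e f.2 + hact f e.2 + e.2 _|_ f.2)).

Lemma emulE e f : emul e f =
  (e.1.1 * f.1.1, e.1.1 *: f.1.2 + f.1.1 *: e.1.2 + circ e.1.2 f.1.2,
   hact e f.2 + hact f e.2 + e.2 _|_ f.2).
Proof. by rewrite /emul unlock. Qed.

Lemma emulC e f : emul e f = emul f e.
Proof.
by rewrite !emulE mulrC circC pc_perpC [_ *: _ + _]addrC [hact _ _ + _]addrC.
Qed.

Lemma hactPl c e e' a : hact (c *: e + e') a = c *: hact e a + hact e' a.
Proof. by rewrite /hact linearPl [in LHS]scalerDl -scalerA scalerDD. Qed.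

Lemma hactPr e c a a' : hact e (c *: a + a') = c *: hact e a + hact e a'.
Proof.
by rewrite /hact linearPr scalerDr !scalerA [_ * c]mulrC -scalerA scalerDD.
Qed.

Lemma emulPl c e e' f : emul (c *: e + e') f = c *: emul e f + emul e' f.
Proof.
rewrite !emulE hactPl hactPr linearPl !scalerDD.
congr (_, _, _); first by rewrite mulrDl -scalerAl.
rewrite circPl [in LHS]scalerDl -[in LHS]scalerA [in LHS]scalerDr.
by rewrite ![in LHS]scalerA [_ * c]mulrC -![in LHS]scalerA !scalerDD.
Qed.

Fact emul_bilinear : bilinear_for *:%R *:%R emul.
Proof. by split=> [f c e e'|f c e e'] /=; rewrite ?[emul f _]emulC emulPl. Qed.

HB.instance Definition _ :=
  bilinear_isBilinear.Build K E E E *:%R *:%R emul emul_bilinear.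

Definition eone : E := (1, 0, 0).

Lemma eoneM e : emul eone e = e.
Proof.
case: e => [[k x] a]; rewrite emulE /hact /circ /=; congr (_, _, _).
- by rewrite mul1r.
- by rewrite !linear0l linear0r scaler0 scale1r !addr0.
- by rewrite !linear0l scaler0 linear0r scale1r !addr0.
Qed.

Definition lbl (t : option X) : E := if t is Some x then hat (b x) else eone.

Definition lblE (y : option X + X) : E :=
  match y with inl t => lbl t | inr x => plain (b x) end.

Lemma basis_lin_ind (P : A -> Prop) :
  P 0 -> (forall c a a', P a -> P a' -> P (c *: a + a')) ->
  (forall x, P (b x)) -> forall a, P a.
Proof.
move=> P0 Pl Pb a; rewrite -(b_crd a); elim/malg_lin_ind: (crd a).
- by rewrite linear0.
- by move=> c g h; rewrite linearP; apply: Pl.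
- by move=> x; rewrite lextU.
Qed.

Lemma E_lin_ind (P : E -> Prop) :
  (forall c e f, P e -> P f -> P (c *: e + f)) ->
  P eone -> (forall a, P (hat a)) -> (forall a, P (plain a)) -> forall e, P e.
Proof.
move=> Pl P1 P' Pp [[k x] a].
suff -> : (k, x, a) = k *: eone + (1 *: hat x + plain a).
  exact: (Pl k _ _ P1 (Pl 1 _ _ (P' x) (Pp a))).
congr (_, _, _); rewrite /= ?scaler0 ?scale1r ?add0r ?addr0 //.
by rewrite [RHS]mulr1.
Qed.

Lemma lblE_ind (P : E -> Prop) : P 0 ->
  (forall c e f, P e -> P f -> P (c *: e + f)) -> (forall y, P (lblE y)) ->
  forall e, P e.
Proof.
move=> P0 Pl PE; have P1 := PE (inl None); elim/E_lin_ind => // a.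
  elim/basis_lin_ind: a => // [c a a' Pa Pa'|x]; last exact: (PE (inl (Some x))).
  by rewrite hatP; apply: Pl.
elim/basis_lin_ind: a => // [c a a' Pa Pa'|x]; last exact: (PE (inr x)).
by rewrite plainP; apply: Pl.
Qed.

Lemma emulZ e c f f' : emul e (c *: f + f') = c *: emul e f + emul e f'.
Proof. exact: linearPr. Qed.

Lemma emulE1 e : emul e eone = e. Proof. by rewrite emulC eoneM. Qed.

Lemma emul_hat x y : emul (hat x) (hat y) = hat (circ x y).
Proof.
rewrite emulE /hact /= mulr0 !scale0r !linear0r.
by rewrite !(add0r, addr0).
Qed.

Lemma emul_hat_plain x a : emul (hat x) (plain a) = plain (x >- a).
Proof.
rewrite emulE /hact /circ /= mulr0 !scale0r !linear0r !linear0l.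
by rewrite !(add0r, addr0).
Qed.

Lemma emul_plain_hat x a : emul (plain a) (hat x) = plain (x >- a).
Proof. by rewrite emulC emul_hat_plain. Qed.

Lemma emul_plain a a' : emul (plain a) (plain a') = plain (a _|_ a').
Proof.
rewrite emulE /hact /circ /= mulr0 !scale0r !linear0r !linear0l.
by rewrite !(add0r, addr0).
Qed.

(** Besides the unit, eight cases remain, one for each choice of [hat] or [plain] in the three
    places; each is a law of postcommutative algebras or a consequence of these laws. *)
Lemma emulA e f g : emul e (emul f g) = emul (emul e f) g.
Proof.
have emul_gen := (emul_hat, emul_hat_plain, emul_plain_hat, emul_plain).
elim/E_lin_ind: e => [c e e' IH IH'||x|x]; rewrite ?emulPl ?IH ?IH' ?eoneM //;
elim/E_lin_ind: f => [c f f' IH IH'||y|y];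
  rewrite ?(emulZ, emulPl) ?IH ?IH' ?(eoneM, emulE1) //;
elim/E_lin_ind: g => [c g g' IH IH'||z|z];
  rewrite ?(emulZ, emulPl) ?IH ?IH' ?(eoneM, emulE1) // !emul_gen.
- by rewrite circA.
- by rewrite circ_succ.
- by rewrite succCA -circ_succ circC.
- by rewrite pc_succ_perp.
- by rewrite circ_succ succCA.
- by rewrite pc_perp_succ.
- by rewrite perp_succ.
- by rewrite pc_perpA.
Qed.

(** * Linear maps out of E and the quasi-shuffle algebra of H *)

Definition alin (Z : lmodType K) (F : X -> Z) (a : A) : Z := lext F (crd a).

Definition elin (Z : lmodType K) (F : option X + X -> Z) (e : E) : Z :=
  e.1.1 *: F (inl None) + alin (fun x => F (inl (Some x))) e.1.2
  + alin (fun x => F (inr x)) e.2.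

Lemma elinPr (Z : lmodType K) (F : option X + X -> Z) c e f :
  elin F (c *: e + f) = c *: elin F e + elin F f.
Proof.
by rewrite /elin /alin !linearP [in LHS]scalerDl -[in LHS]scalerA !scalerDD.
Qed.

Lemma elin_lbl (Z : lmodType K) (F : option X + X -> Z) y : elin F (lblE y) = F y.
Proof.
rewrite /elin /alin; case: y => [[x|]|x] /=;
  rewrite !(linear0, scale0r, scale1r, addr0, add0r) ?crd_b ?lextU //.
Qed.

(* The letters [None] and [Some x] stand for the basis vectors 1 and x' of H. *)
Definition D := {malg K[seq (option X)]}.
HB.instance Definition _ := GRing.Lmodule.on D.

Definition dnil : D := << [::] >>.

Definition cons_lbl (y : option X + X) (w : seq (option X)) : D :=
  if y is inl t then << t :: w >> else 0.

(* Prepending a letter goes through the projection of E onto H along A, an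
   algebra morphism; it thus makes sense for every element of E. *)
Definition dcons : E -> D -> D := locked_with mul_key (fun e =>
  lext (fun w => elin (fun y => cons_lbl y w) e)).

Lemma dconsE e d : dcons e d = lext (fun w => elin (fun y => cons_lbl y w) e) d.
Proof. by rewrite /dcons unlock. Qed.

Lemma dconsPl c e f d : dcons (c *: e + f) d = c *: dcons e d + dcons f d.
Proof.
rewrite !dconsE -lext_linl; apply: eq_lext => w.
by rewrite elinPr.
Qed.

Fact dcons_bilinear : bilinear_for *:%R *:%R dcons.
Proof.
split=> [d c e e'|e c d d'] /=; first exact: dconsPl.
by rewrite !dconsE linearP.
Qed.

HB.instance Definition _ :=
  bilinear_isBilinear.Build K E D D *:%R *:%R dcons dcons_bilinear.

Lemma dcons_lbl y w : dcons (lblE y) << w >> = cons_lbl y w.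
Proof. by rewrite dconsE lextU elin_lbl. Qed.

Lemma D_basis_ind (P : D -> Prop) :
  P 0 -> (forall c d d', P d -> P d' -> P (c *: d + d')) ->
  (forall w, P << w >>) -> forall d, P d.
Proof. exact: malg_lin_ind. Qed.

Lemma D_cons_ind (P : D -> Prop) :
  P 0 -> (forall c d d', P d -> P d' -> P (c *: d + d')) ->
  P dnil -> (forall e d, P d -> P (dcons e d)) -> forall d, P d.
Proof.
move=> P0 Pl P1 Pc; apply: malg_lin_ind => //; elim=> // t w Pw.
by have := Pc (lblE (inl t)) _ Pw; rewrite dcons_lbl.
Qed.

(** The quasi-shuffle product of two words. The inner [fix] serves the term in which only the second
    word shrinks. *)
Fixpoint qsh (u : seq (option X)) : seq (option X) -> D :=
  match u with
  | [::] => fun v => << v >>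
  | s :: u' => fix qsh_u v := match v with
    | [::] => << u >>
    | t :: v' => dcons (lbl s) (qsh u' v) + dcons (lbl t) (qsh_u v')
        + dcons (emul (lbl s) (lbl t)) (qsh u' v')
    end
  end.

Lemma qsh_cons s t u v : qsh (s :: u) (t :: v) =
  dcons (lbl s) (qsh u (t :: v)) + dcons (lbl t) (qsh (s :: u) v)
  + dcons (emul (lbl s) (lbl t)) (qsh u v).
Proof. by []. Qed.

Definition dmul : D -> D -> D := locked_with mul_key (fun d d' =>
  lext (fun u => lext (qsh u) d') d).

Lemma dmulE d d' : dmul d d' = lext (fun u => lext (qsh u) d') d.
Proof. by rewrite /dmul unlock. Qed.

Lemma dmulPr d c e e' : dmul d (c *: e + e') = c *: dmul d e + dmul d e'.
Proof.
rewrite !dmulE -lext_linl; apply: eq_lext => w.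
by rewrite linearP.
Qed.

Fact dmul_bilinear : bilinear_for *:%R *:%R dmul.
Proof.
split=> [d c e e'|e c d d'] /=; last exact: dmulPr.
by rewrite !dmulE linearP.
Qed.

HB.instance Definition _ :=
  bilinear_isBilinear.Build K D D D *:%R *:%R dmul dmul_bilinear.

Lemma dmulU u v : dmul << u >> << v >> = qsh u v.
Proof. by rewrite dmulE !lextU. Qed.

Lemma dmul1 d : dmul dnil d = d.
Proof.
elim/D_basis_ind: d => [|c d d' IH IH'|w]; last exact: dmulU.
  by rewrite linear0r.
by rewrite linearPr /= IH IH'.
Qed.

Lemma dconsPr e c d d' : dcons e (c *: d + d') = c *: dcons e d + dcons e d'.
Proof. exact: linearPr. Qed.

Lemma dmulPl c d d' e : dmul (c *: d + d') e = c *: dmul d e + dmul d' e.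
Proof. exact: linearPl. Qed.

Lemma dcons_plain a d : dcons (plain a) d = 0.
Proof.
elim/basis_lin_ind: a => [|c a a' IH IH'|x].
- exact: linear0l.
- by rewrite plainP linearPl /= IH IH' scaler0 addr0.
elim/D_basis_ind: d => [|c d d' IH IH'|w]; first exact: linear0r.
  by rewrite linearPr /= IH IH' scaler0 addr0.
by rewrite (dcons_lbl (inr x)).
Qed.

Lemma dcons_e0 e d : dcons e d = dcons (e.1, 0) d.
Proof.
have {1}-> : e = 1 *: (e.1, 0) + plain e.2 :> E.
  case: e => [[k x] a]; congr (_, _, _); rewrite /= ?scale1r ?scaler0 ?addr0 //.
  by rewrite ?add0r //; apply/esym/mul1r.
by rewrite linearPl /= dcons_plain addr0 scale1r.
Qed.

Lemma dcons_proj0 e d : e.1 = 0 -> dcons e d = 0.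
Proof. by case: e => e a /= ->; exact: dcons_plain. Qed.

Lemma emul_plain1 a e : (emul (plain a) e).1 = 0.
Proof.
by rewrite emulE /= mul0r !scale0r /circ scaler0 !linear0l linear0r !addr0.
Qed.

(** The recursion of [qsh], extended from letters to all of E. This is consistent because the
    projection onto H along A is multiplicative. *)
Lemma dmul_cons e f d d' : dmul (dcons e d) (dcons f d') =
  dcons e (dmul d (dcons f d')) + dcons f (dmul (dcons e d) d')
  + dcons (emul e f) (dmul d d').
Proof.
elim/lblE_ind: e => [|c e e' IH IH'|s].
- by rewrite !(linear0l, linear0r) !addr0.
- by rewrite !(dconsPl, dconsPr, dmulPl, dmulPr, emulPl, emulZ) IH IH' !scalerDD.
elim/lblE_ind: f => [|c f f' IH IH'|t].
- by rewrite !(linear0l, linear0r) !addr0.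
- by rewrite !(dconsPl, dconsPr, dmulPl, dmulPr, emulPl, emulZ) IH IH' !scalerDD.
elim/D_basis_ind: d => [|c d e IH IH'|u].
- by rewrite !(linear0l, linear0r) !addr0.
- by rewrite !(dconsPl, dconsPr, dmulPl, dmulPr, emulPl, emulZ) IH IH' !scalerDD.
elim/D_basis_ind: d' => [|c d e IH IH'|v].
- by rewrite !(linear0l, linear0r) !addr0.
- by rewrite !(dconsPl, dconsPr, dmulPl, dmulPr, emulPl, emulZ) IH IH' !scalerDD.
(* A letter from A makes every term vanish, as A is an ideal of E and [dcons] kills it. *)
case: s => [s|x]; last first.
  rewrite !(@dcons_proj0 (emul _ _)) ?emul_plain1 // !dcons_plain.
  by rewrite !(linear0l, linear0r) !addr0.
case: t => [t|x]; last first.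
  rewrite emulC !(@dcons_proj0 (emul _ _)) ?emul_plain1 // !dcons_plain.
  by rewrite !(linear0l, linear0r) !addr0.
by rewrite !dcons_lbl !dmulU.
Qed.

Lemma dmulr1 d : dmul d dnil = d.
Proof.
elim/D_basis_ind: d => [|c d d' IH IH'|w]; first by rewrite linear0l.
  by rewrite dmulPl IH IH'.
by rewrite dmulU; case: w.
Qed.

Lemma dmulC d d' : dmul d d' = dmul d' d.
Proof.
elim/D_cons_ind: d d' => [|c d e IH IH'||e d IH] d'.
- by rewrite linear0l linear0r.
- by rewrite dmulPl dmulPr IH IH'.
- by rewrite dmul1 dmulr1.
elim/D_cons_ind: d' => [|c d' f IH1 IH2||f d' IH'].
- by rewrite linear0l linear0r.
- by rewrite dmulPl dmulPr IH1 IH2.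
- by rewrite dmul1 dmulr1.
by rewrite !dmul_cons IH' !IH emulC [dcons e _ + _]addrC.
Qed.

(** Each side expands to nine terms by [dmul_cons]; the terms led by the letter of an outer factor
    recombine into a single product, to which induction applies. *)
Lemma dmulA d d' d'' : dmul d (dmul d' d'') = dmul (dmul d d') d''.
Proof.
elim/D_cons_ind: d d' d'' => [|c d e IH IH'||e d IHd] d' d''.
- by rewrite !linear0l.
- by rewrite !dmulPl IH IH'.
- by rewrite !dmul1.
elim/D_cons_ind: d' d'' => [|c d' f IH1 IH2||f d' IHd'] d''.
- by rewrite !(linear0l, linear0r).
- by rewrite dmulPl !dmulPr dmulPl IH1 IH2.
- by rewrite dmul1 dmulr1.
elim/D_cons_ind: d'' => [|c d'' g IH1 IH2||g d'' IHd''].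
- by rewrite !linear0r.
- by rewrite !dmulPr IH1 IH2.
- by rewrite !dmulr1.
have dmulDl u v w : dmul (u + v) w = dmul u w + dmul v w by rewrite linearDl.
have dmulDr u v w : dmul u (v + w) = dmul u v + dmul u w by rewrite linearDr.
have dconsD k u v : dcons k (u + v) = dcons k u + dcons k v by rewrite linearDr.
rewrite [dmul (dcons f d') _]dmul_cons [dmul (dcons e d) (dcons f d')]dmul_cons.
rewrite !(dmulDl, dmulDr) !dmul_cons.
rewrite [LHS]addr9l [RHS]addr9r.
rewrite -!dconsD -!dmulDr -!dmulDl -!dmul_cons IHd IHd''.
by rewrite !IHd !IHd' emulA.
Qed.

(** * The algebra E (x) D, free on pairs of a basis vector of E and a word *)

Definition M := {malg K[((option X + X) * seq (option X))%type]}.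
HB.instance Definition _ := GRing.Lmodule.on M.

Definition ten : E -> D -> M := locked_with mul_key (fun e =>
  lext (fun w => elin (fun y => << (y, w) >> : M) e)).

Lemma tenE e d : ten e d = lext (fun w => elin (fun y => << (y, w) >> : M) e) d.
Proof. by rewrite /ten unlock. Qed.

Lemma tenPl c e f d : ten (c *: e + f) d = c *: ten e d + ten f d.
Proof.
rewrite !tenE -lext_linl; apply: eq_lext => w.
by rewrite elinPr.
Qed.

Fact ten_bilinear : bilinear_for *:%R *:%R ten.
Proof.
by split=> [d c e e'|e c d d'] /=; [exact: tenPl | rewrite !tenE linearP].
Qed.

HB.instance Definition _ :=
  bilinear_isBilinear.Build K E D M *:%R *:%R ten ten_bilinear.

Lemma tenPr e c d d' : ten e (c *: d + d') = c *: ten e d + ten e d'.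
Proof. exact: linearPr. Qed.

Lemma tenDr e d d' : ten e (d + d') = ten e d + ten e d'.
Proof. exact: linearDr. Qed.

Lemma ten_lbl y w : ten (lblE y) << w >> = << (y, w) >>.
Proof. by rewrite tenE lextU elin_lbl. Qed.

Lemma M_basis_ind (P : M -> Prop) :
  P 0 -> (forall c m n, P m -> P n -> P (c *: m + n)) ->
  (forall y w, P << (y, w) >>) -> forall m, P m.
Proof. by move=> P0 Pl Pb; apply: malg_lin_ind => // -[y w]. Qed.

Lemma M_ten_ind (P : M -> Prop) :
  P 0 -> (forall c m n, P m -> P n -> P (c *: m + n)) ->
  (forall e d, P (ten e d)) -> forall m, P m.
Proof. by move=> P0 Pl Pt; apply: M_basis_ind => // y w; rewrite -ten_lbl. Qed.

Definition mmul : M -> M -> M := locked_with mul_key (fun m m' =>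
  lext (fun p => lext (fun q => ten (emul (lblE p.1) (lblE q.1))
    (dmul << p.2 >> << q.2 >>)) m') m).

Lemma mmulE m m' : mmul m m' = lext (fun p => lext (fun q =>
  ten (emul (lblE p.1) (lblE q.1)) (dmul << p.2 >> << q.2 >>)) m') m.
Proof. by rewrite /mmul unlock. Qed.

Fact mmul_bilinear : bilinear_for *:%R *:%R mmul.
Proof.
split=> [m c n n'|m c n n'] /=; first by rewrite !mmulE linearP.
rewrite !mmulE -lext_linl; apply: eq_lext => p.
by rewrite linearP.
Qed.

HB.instance Definition _ :=
  bilinear_isBilinear.Build K M M M *:%R *:%R mmul mmul_bilinear.

Lemma mmulPl c m m' n : mmul (c *: m + m') n = c *: mmul m n + mmul m' n.
Proof. exact: linearPl. Qed.

Lemma mmulPr m c n n' : mmul m (c *: n + n') = c *: mmul m n + mmul m n'.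
Proof. exact: linearPr. Qed.

Lemma mmulZl c m n : mmul (c *: m) n = c *: mmul m n.
Proof. exact: linearZl_LR. Qed.

Lemma mmulZr c m n : mmul m (c *: n) = c *: mmul m n.
Proof. exact: linearZr_LR. Qed.

Lemma mmul_ten e f d d' : mmul (ten e d) (ten f d') = ten (emul e f) (dmul d d').
Proof.
elim/lblE_ind: e => [|c e e' IH IH'|s].
- by rewrite !(linear0l, linear0r).
- by rewrite !(tenPl, emulPl, mmulPl) IH IH'.
elim/lblE_ind: f => [|c f f' IH IH'|t].
- by rewrite !(linear0l, linear0r).
- by rewrite !(tenPl, emulZ, mmulPr) IH IH'.
elim/D_basis_ind: d => [|c d e IH IH'|u].
- by rewrite !(linear0l, linear0r).
- by rewrite !(tenPr, dmulPl, mmulPl) IH IH'.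
elim/D_basis_ind: d' => [|c d e IH IH'|v].
- by rewrite !(linear0l, linear0r).
- by rewrite !(tenPr, dmulPr, mmulPr) IH IH'.
by rewrite !ten_lbl mmulE !lextU.
Qed.

Definition mone := ten eone dnil.

Fact mmulC : commutative mmul.
Proof.
move=> m n; elim/M_ten_ind: m => [|c m m' IH IH'|e d].
- by rewrite linear0l linear0r.
- by rewrite mmulPl mmulPr IH IH'.
elim/M_ten_ind: n => [|c n n' IH IH'|f d'].
- by rewrite linear0l linear0r.
- by rewrite mmulPl mmulPr IH IH'.
by rewrite !mmul_ten emulC dmulC.
Qed.

Fact mmulA : associative mmul.
Proof.
move=> m n p; elim/M_ten_ind: m => [|c m m' IH IH'|e d].
- by rewrite !linear0l.
- by rewrite !mmulPl IH IH'.
elim/M_ten_ind: n => [|c n n' IH IH'|f d'].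
- by rewrite !(linear0l, linear0r).
- by rewrite !(mmulPl, mmulPr) IH IH'.
elim/M_ten_ind: p => [|c p p' IH IH'|g d''].
- by rewrite !linear0r.
- by rewrite !mmulPr IH IH'.
by rewrite !mmul_ten emulA dmulA.
Qed.

Fact mmul1 : left_id mone mmul.
Proof.
move=> m; elim/M_ten_ind: m => [|c m m' IH IH'|e d].
- by rewrite linear0r.
- by rewrite mmulPr IH IH'.
by rewrite mmul_ten eoneM dmul1.
Qed.

Fact mmulDl : left_distributive mmul +%R.
Proof. by move=> m n p; rewrite linearDl. Qed.

Fact mone_neq0 : mone != 0.
Proof.
rewrite /mone -[eone]/(lblE (inl None)) ten_lbl; apply/eqP => /malgP.
by move=> /(_ (inl None, [::]))/eqP; rewrite mcoeffUU mcoeff0 oner_eq0.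
Qed.

HB.instance Definition _ := GRing.Zmodule_isComNzRing.Build M
  mmulA mmulC mmul1 mmulDl mone_neq0.

Lemma ten_mul e f d d' : ten e d * ten f d' = ten (emul e f) (dmul d d').
Proof. exact: mmul_ten. Qed.

(** The value of R on a (x) w. For w = t w' this element is (a (x) 1) R(p) with p = t (x) w', so the
    Rota-Baxter identity solved for R(a R(p)) yields the three terms, the last being R of an element
    with a shorter word. *)
Fixpoint rb_plain (w : seq (option X)) (a : A) : M :=
  if w is t :: w' then
    ten (hat a) << w >> - ten eone (dcons (emul (hat a) (lbl t)) << w' >>)
    - rb_plain w' (hact (lbl t) a)
  else ten (hat a) << w >>.

Definition rb_lbl (p : (option X + X) * seq (option X)) : M :=
  match p.1 with
  | inl t => ten eone (dcons (lbl t) << p.2 >>)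
  | inr x => rb_plain p.2 (b x)
  end.

Definition rb_fun : M -> M := locked_with mul_key (lext rb_lbl).

Fact rb_fun_linear : linear rb_fun.
Proof. by move=> c m n; rewrite /rb_fun unlock linearP. Qed.

HB.instance Definition _ := GRing.isLinear.Build K M M *:%R rb_fun rb_fun_linear.

Definition rbM : {linear M -> M} := rb_fun.

Lemma rbMU p : rbM << p >> = rb_lbl p.
Proof. by rewrite /rbM /= /rb_fun unlock lextU. Qed.

Lemma rbMP c m n : rbM (c *: m + n) = c *: rbM m + rbM n.
Proof. exact: linearP. Qed.

Lemma rbMD m n : rbM (m + n) = rbM m + rbM n.
Proof. exact: linearD. Qed.

Lemma plain0 : plain 0 = 0. Proof. by []. Qed.

(** Splits [e] along E = H + A; the first term may keep all of [e], since prepending ignores the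
    component in A. *)
Lemma rbM_proj e d :
  rbM (ten e d) = ten eone (dcons e d) + rbM (ten (plain e.2) d).
Proof.
elim/lblE_ind: e => [|c e f IH IH'|[t|x]].
- by rewrite plain0 !linear0l linear0r linear0 addr0.
- rewrite plainP !tenPl !rbMP IH IH' /= dconsPl tenPr.
  by rewrite scalerDD.
- have -> : (lblE (inl t)).2 = 0 by case: t.
  rewrite plain0 linear0l linear0 addr0.
  elim/D_basis_ind: d => [|c d d' IH IH'|w]; first by rewrite !linear0r linear0.
    by rewrite !(tenPr, dconsPr) rbMP IH IH'.
  by rewrite ten_lbl rbMU.
- by rewrite [lblE _]/= dcons_plain linear0r add0r.
Qed.

Lemma rbM_H e d : e.2 = 0 -> rbM (ten e d) = ten eone (dcons e d).
Proof. by move=> e0; rewrite rbM_proj e0 plain0 linear0l linear0 addr0. Qed.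

Lemma rb_plainP w c a a' :
  rb_plain w (c *: a + a') = c *: rb_plain w a + rb_plain w a'.
Proof.
elim: w a a' => [|t w IH] a a' /=; first by rewrite hatP tenPl.
rewrite hatP emulPl tenPl dconsPl tenPr hactPr IH.
exact: scalerBBD.
Qed.

Lemma rbM_plain a w : rbM (ten (plain a) << w >>) = rb_plain w a.
Proof.
elim/basis_lin_ind: a => [|c a a' IH IH'|x].
- rewrite plain0 linear0l linear0; apply/eqP; rewrite eq_sym -subr_eq0; apply/eqP.
  have := rb_plainP w (-1) 0 0.
  by rewrite scaler0 addr0 scaleN1r addNr => ->; rewrite subr0.
- by rewrite plainP tenPl rbMP IH IH' rb_plainP.
by rewrite (ten_lbl (inr x)) rbMU.
Qed.

Lemma rbM_plain1 a : rbM (ten (plain a) dnil) = ten (hat a) dnil.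
Proof. exact: rbM_plain. Qed.

Lemma hact0 a : hact 0 a = 0.
Proof. by rewrite /hact /= scale0r linear0l addr0. Qed.

(** The recursion of [rb_plain] with its first letter replaced by an element of E; for an element of
    A all terms vanish. *)
Lemma rbM_plain_cons a e d : rbM (ten (plain a) (dcons e d)) =
  ten (hat a) (dcons e d) - ten eone (dcons (emul (hat a) e) d)
  - rbM (ten (plain (hact e a)) d).
Proof.
elim/lblE_ind: e => [|c e f IH IH'|[t|x]].
- by rewrite hact0 plain0 !(linear0l, linear0r) !linear0 !(subr0, addr0).
- rewrite dconsPl emulZ dconsPl hactPl plainP !tenPl !tenPr !rbMP IH IH'.
  exact/esym/scalerBBD.
- elim/D_basis_ind: d => [|c d d' IH IH'|w].
  + by rewrite !(linear0l, linear0r) !linear0 !(subr0, addr0).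
  + rewrite !dconsPr !tenPr !rbMP IH IH'.
    exact/esym/scalerBBD.
  by rewrite dcons_lbl !rbM_plain.
have -> : hact (plain (b x)) a = 0 by rewrite /hact /= scale0r linear0l addr0.
rewrite emul_hat_plain !dcons_plain plain0 !(linear0l, linear0r) !linear0.
by rewrite !(subr0, addr0).
Qed.

Lemma emul_proj0 e f : e.2 = 0 -> f.2 = 0 -> (emul e f).2 = 0.
Proof.
by move=> e0 f0; rewrite emulE /= e0 f0 /hact !scaler0 !linear0r !addr0.
Qed.

(** * The Rota-Baxter identity in the model *)

Lemma rbMB : {morph rbM : m n / m - n >-> m - n}.
Proof. exact: linearB. Qed.

Lemma rbM_pair m n :
  rb_pair rbM m n <-> rbM m * rbM n = rbM (rbM m * n) + rbM (m * rbM n) + rbM (m * n).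
Proof. by rewrite /rb_pair /star !rbMD. Qed.

(** On H (x) D the identity is the quasi-shuffle recursion [dmul_cons]. *)
Lemma rb_HH e f d d' : e.2 = 0 -> f.2 = 0 ->
  rb_pair rbM (ten e d) (ten f d').
Proof.
move=> e0 f0; apply/rbM_pair; rewrite !rbM_H // !ten_mul !eoneM emulE1.
by rewrite !rbM_H ?emul_proj0 // dmul_cons !tenDr [ten eone (dcons f _) + _]addrC.
Qed.

Lemma emul_plain_H a e : e.2 = 0 -> emul (plain a) e = plain (hact e a).
Proof.
by move=> e0; rewrite emulC emulE /hact /= mulr0 !scale0r e0 scaler0 /circ
  !(linear0l, linear0r) !addr0.
Qed.

(** This is the identity by which R was defined on [ten (plain a) (dcons e d)]. *)
Lemma rb_plain_H a e d : e.2 = 0 ->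
  rb_pair rbM (ten (plain a) dnil) (ten e d).
Proof.
move=> e0; apply/rbM_pair; rewrite rbM_plain1 !rbM_H // !ten_mul !emulE1 !dmul1.
rewrite rbM_plain_cons rbM_H ?emul_proj0 // emul_plain_H //.
by rewrite -addrA addrAC [RHS]addrC; ring.
Qed.

Lemma star_plain a c : star rbM (ten (plain a) dnil) (ten (plain c) dnil) =
  ten (plain (circ a c)) dnil.
Proof.
have plainD x y : plain (x + y) = plain x + plain y.
  by rewrite -{1}[x]scale1r plainP scale1r.
rewrite /star !rbM_plain1 !ten_mul emul_hat_plain emul_plain_hat emul_plain.
by rewrite dmul1 /circ !plainD !linearDl.
Qed.

Lemma rb_plain_plain1 a c : rb_pair rbM (ten (plain a) dnil) (ten (plain c) dnil).
Proof.
by rewrite /rb_pair star_plain !rbM_plain1 ten_mul emul_hat dmul1.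
Qed.

Lemma rb_pair_lin x c m n :
  rb_pair rbM x m -> rb_pair rbM x n -> rb_pair rbM x (c *: m + n).
Proof.
move=> /rbM_pair xm /rbM_pair xn; apply/rbM_pair.
have mulE (y m' n' : M) : y * (c *: m' + n') = c *: (y * m') + y * n' by exact: mmulPr.
by rewrite rbMP !mulE !rbMP xm xn !scalerDD.
Qed.

Lemma rb_pair0 x : rb_pair rbM x 0.
Proof. by apply/rbM_pair; rewrite !(linear0, mulr0) !addr0. Qed.

Lemma ten_split e d : ten e d = ten (e.1, 0) d + ten (plain e.2) d.
Proof.
rewrite -linearDl; congr (ten _ d); case: e => [[k x] a].
by congr (_, _, _); rewrite /= ?addr0 ?add0r.
Qed.

Lemma ten_dcons a e d : e.2 = 0 ->
  ten (plain a) (dcons e d) = ten (plain a) dnil * rbM (ten e d).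
Proof. by move=> e0; rewrite rbM_H // ten_mul emulE1 dmul1. Qed.

Lemma rb_plain_plain a c d : rb_pair rbM (ten (plain a) dnil) (ten (plain c) d).
Proof.
elim/D_cons_ind: d c => [|k d d' IH IH'||e d IH] c.
- by rewrite linear0r; exact: rb_pair0.
- by rewrite tenPr; apply: rb_pair_lin.
- exact: rb_plain_plain1.
(* With the A component of [e] dropped, the second element is c R(q) for q = e (x) d. *)
rewrite dcons_e0 ten_dcons //; apply: (rb_pair_mulR_swap rbMB).
- exact: rb_plain_plain1.
- exact: rb_plain_H.
- by rewrite star_plain; apply: rb_plain_H.
- by rewrite rbM_plain1 ten_mul; apply: rb_plain_H; rewrite emul_proj0.
- by rewrite ten_mul emul_plain_H // dmul1.
Qed.

Lemma rb_pair_ten x m :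
  (forall e d, e.2 = 0 -> rb_pair rbM x (ten e d)) ->
  (forall a d, rb_pair rbM x (ten (plain a) d)) -> rb_pair rbM x m.
Proof.
move=> xH xp; elim/M_ten_ind: m => [|c m m'|e d]; first exact: rb_pair0.
  exact: rb_pair_lin.
rewrite ten_split -[ten (e.1, 0) d]scale1r; apply: rb_pair_lin; first exact: xH.
exact: xp.
Qed.

Lemma rb_plain_any a m : rb_pair rbM (ten (plain a) dnil) m.
Proof. by apply: rb_pair_ten => *; [apply: rb_plain_H | apply: rb_plain_plain]. Qed.

(** Induction on [d]: a (x) (e d) is (a (x) 1) R(p) with p in H (x) D, and [rb_pair_mulR] leads back
    to [d] and to known pairs. *)
Lemma rb_any_plain m : (forall e d, e.2 = 0 -> rb_pair rbM m (ten e d)) ->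
  forall a d, rb_pair rbM m (ten (plain a) d).
Proof.
move=> mH a d; elim/D_cons_ind: d a => [|k d d' IH IH'||e d IH] a.
- by rewrite linear0r; exact: rb_pair0.
- by rewrite tenPr; apply: rb_pair_lin.
- exact/rb_pairC/rb_plain_any.
rewrite dcons_e0 ten_dcons //; apply/rb_pairC/(rb_pair_mulR rbMB).
- exact: rb_plain_H.
- exact/rb_pairC/mH.
- by rewrite rbM_plain1 ten_mul; apply/rb_pairC/mH; rewrite emul_proj0.
- by rewrite ten_mul emul_plain_H // dmul1; apply/rb_pairC/IH.
- exact: rb_plain_any.
Qed.

(** First one factor lies in H (x) D and the other is arbitrary; by symmetry an arbitrary factor
    pairs with H (x) D, and [rb_any_plain] extends this to everything. *)
Lemma rbM_rb m n : rb_pair rbM m n.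
Proof.
have HH e d x : e.2 = 0 -> rb_pair rbM (ten e d) x.
  move=> e0; have H f d' : f.2 = 0 -> rb_pair rbM (ten e d) (ten f d').
    exact: rb_HH.
  by apply: rb_pair_ten H (rb_any_plain H).
have H e d : e.2 = 0 -> rb_pair rbM m (ten e d).
  by move=> e0; apply/rb_pairC/HH.
exact: rb_pair_ten H (rb_any_plain H).
Qed.

(** * Degree bounds for the operations of the model *)

Definition edeg (y : option X + X) : nat := if y is inl None then 0%N else 1%N.

(** The filtration of E: multiples of the unit for [n = 0], and no condition from degree 1 on. *)
Definition edeg_le n (e : E) : Prop := n = 0%N -> e.1.2 = 0 /\ e.2 = 0.

Definition wdeg (w : seq (option X)) : nat := count isSome w.

Definition mdeg (p : (option X + X) * seq (option X)) : nat :=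
  (edeg p.1 + wdeg p.2)%N.

Lemma edeg_lbl y : edeg_le (edeg y) (lblE y).
Proof. by case: y => [[x|]|x]. Qed.

Lemma edeg_emul m n e f :
  edeg_le m e -> edeg_le n f -> edeg_le (m + n)%N (emul e f).
Proof.
move=> em fn /eqP; rewrite addn_eq0 => /andP[/eqP /em[e1 e2] /eqP /fn[f1 f2]].
rewrite emulE /= e1 e2 f1 f2 /hact /circ !linear0r !scaler0.
by rewrite !addr0.
Qed.

Lemma deg_le_elin (Y : choiceType) (deg : Y -> nat)
    (F : option X + X -> {malg K[Y]}) k n e :
  edeg_le k e -> (forall y, (edeg y <= k)%N -> deg_le deg n (F y)) ->
  deg_le deg n (elin F e).
Proof.
rewrite /elin /alin => ek Fn; apply: deg_leD; first apply: deg_leD.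
- exact/deg_leZ/Fn.
- case: k => [|k] in ek Fn *.
    by have [-> _] := ek erefl; rewrite !linear0; apply: deg_le0.
  by apply: (deg_le_lext (deg := fun=> 0%N) (n := 0)) => // x _; apply: Fn.
case: k => [|k] in ek Fn *.
  by have [_ ->] := ek erefl; rewrite !linear0; apply: deg_le0.
by apply: (deg_le_lext (deg := fun=> 0%N) (n := 0)) => // x _; apply: Fn.
Qed.

Lemma dcons_deg k n e d : edeg_le k e -> deg_le wdeg n d ->
  deg_le wdeg (k + n)%N (dcons e d).
Proof.
move=> ek dn; rewrite dconsE; apply: deg_le_lext dn _ => w wn.
apply: deg_le_elin ek _ => -[t|x] yk; last exact: deg_le0.
apply/deg_leU/(leq_trans _ (leq_add yk wn)).
by case: t {yk}.
Qed.

Lemma ten_deg k n e d : edeg_le k e -> deg_le wdeg n d ->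
  deg_le mdeg (k + n)%N (ten e d).
Proof.
move=> ek dn; rewrite tenE; apply: deg_le_lext dn _ => w wn.
by apply: deg_le_elin ek _ => y yk; apply/deg_leU/leq_add.
Qed.

Lemma qsh_deg u v : deg_le wdeg (wdeg u + wdeg v)%N (qsh u v).
Proof.
elim: u v => [|s u IHu] v; first exact: deg_leU.
elim: v => [|t v IHv]; first by apply/deg_leU/leq_addr.
have lblP r : edeg_le (isSome r) (lbl r) by case: r.
rewrite qsh_cons; apply: deg_leD; first apply: deg_leD.
- apply: (deg_leW (dcons_deg (lblP s) (IHu (t :: v))) _).
  by rewrite addnA.
- apply: (deg_leW (dcons_deg (lblP t) IHv) _).
  by rewrite /= addnCA.
apply: (deg_leW (dcons_deg (edeg_emul (lblP s) (lblP t)) (IHu v)) _).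
by rewrite /= addnACA.
Qed.

Lemma dmul_deg m n d d' : deg_le wdeg m d -> deg_le wdeg n d' ->
  deg_le wdeg (m + n)%N (dmul d d').
Proof.
move=> dm dn; rewrite dmulE; apply: deg_le_lext dm _ => u um.
apply: deg_le_lext dn _ => v vn; exact: (deg_leW (@qsh_deg u v) (leq_add um vn)).
Qed.

Lemma mmul_deg m n x y : deg_le mdeg m x -> deg_le mdeg n y ->
  deg_le mdeg (m + n)%N (mmul x y).
Proof.
move=> xm yn; rewrite mmulE; apply: deg_le_lext xm _ => p pm.
apply: deg_le_lext yn _ => q qn; apply: (deg_leW _ (leq_add pm qn)).
rewrite /mdeg addnACA; apply: ten_deg; first exact/edeg_emul/edeg_lbl/edeg_lbl.
by apply: dmul_deg; apply: deg_leU.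
Qed.

Lemma rb_plain_deg w a : deg_le mdeg (wdeg w).+1 (rb_plain w a).
Proof.
have hatE c : edeg_le 1 (hat c) by [].
elim: w a => [|t w IH] a /=.
  by apply: (@ten_deg 1 0) => //; apply: deg_leU.
have lblP : edeg_le (isSome t) (lbl t) by case: t.
apply: deg_leB; first apply: deg_leB.
- by apply: (@ten_deg 1) => //; apply: deg_leU.
- apply: (@ten_deg 0) => //.
  apply: (@dcons_deg (1 + isSome t)%N (wdeg w)); last exact: deg_leU.
  exact: edeg_emul.
- by apply: (deg_leW (IH _)); rewrite ltnS leq_addl.
Qed.

Lemma rbM_deg n m : deg_le mdeg n m -> deg_le mdeg n (rbM m).
Proof.
move=> mn; rewrite /rbM /= /rb_fun unlock; apply: deg_le_lext mn _ => -[[t|x] w] tw.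
  apply: (deg_leW _ tw); apply: (@ten_deg 0) => //.
  by apply: (dcons_deg (@edeg_lbl (inl t))); apply: deg_leU.
exact: deg_leW (@rb_plain_deg w (b x)) tw.
Qed.

(** * The model as a Rota-Baxter algebra of weight [lam] *)

Section ModelAlgebra.
Variables (lam : K) (lam0 : lam != 0).

Definition model_op (m : M) : M := lam *: rbM m.

Fact model_op_linear : linear model_op.
Proof.
by move=> c m n; rewrite /model_op rbMP scalerDr !scalerA [lam * c]mulrC.
Qed.

HB.instance Definition _ :=
  GRing.isLinear.Build K M M *:%R model_op model_op_linear.

Fact model_opP m n : mmul (model_op m) (model_op n) =
  model_op (mmul (model_op m) n + mmul m (model_op n) + lam *: mmul m n).
Proof.
have rbE : mmul (rbM m) (rbM n) =
  rbM (mmul (rbM m) n + mmul m (rbM n) + mmul m n) := rbM_rb m n.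
by rewrite /model_op !(mmulZl, mmulZr) rbE -linearZ_LR !scalerDr.
Qed.

Definition model : rbComAlg lam := RBComAlg mmulA mmulC model_opP.

Lemma model_rb1 (m : model) : rb1 m = rbM m.
Proof. by rewrite /rb1 /= /model_op scalerA mulVf ?scale1r. Qed.

Definition model_gen (a : A) : model := ten (plain a) dnil.

Fact model_gen_linear : linear model_gen.
Proof. by move=> c a a'; rewrite /model_gen plainP tenPl. Qed.

HB.instance Definition _ :=
  GRing.isLinear.Build K A model *:%R model_gen model_gen_linear.

Definition model_gen_lin : {linear A -> model} := model_gen.

Lemma model_gen_hom : is_pc_hom (B := psi lam0 model) model_gen_lin.
Proof.
split=> x y; last by rewrite /= /model_gen mmul_ten emul_plain dmul1.
rewrite /= /psi_succ /= /model_op mmulZl scalerA mulVf // scale1r /model_gen.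
by rewrite rbM_plain1 mmul_ten emul_hat_plain dmul1.
Qed.

(** On H (x) D, R moves the E factor to the front of the word and puts the unit in its place. Hence
    the head of the list ends up as the E factor, and the final letter closes the word. *)
Definition code_op (p : seq (option X) * X) : (option X + X) * seq (option X) :=
  if p.1 is t :: s then (inl t, rcons s (Some p.2)) else (inl (Some p.2), [::]).

Definition code_word (q : word X) : (option X + X) * seq (option X) :=
  match q with
  | inl p => code_op p
  | inr (x, None) => (inr x, [::])
  | inr (x, Some p) => (inr x, rcons p.1 (Some p.2))
  end.

Lemma code_word_inj : injective code_word.
Proof.
case=> [[[|s u] x]|[x [[u y]|]]] [[[|t v] x']|[x' [[v y']|]]] //=.
- by case=> ->.
- by case=> _; case: v.
- by case=> _; case: u.
- by case=> -> /rcons_inj[-> ->].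
- by case=> -> /rcons_inj[-> ->].
- by case=> _; case: u.
- by case=> _; case: v.
- by case=> ->.
Qed.

(** Evaluating a word applies R only to basis vectors of H (x) D and to a (x) 1 with a in the basis,
    and R sends these to single basis vectors. In each product one side has the unit in E and the
    other the empty word, so no sum ever arises. *)
Lemma eval_word_model q : eval_word model_gen_lin b q = << code_word q >>.
Proof.
have rbM_inl t w : rbM << (inl t, w) >> = << (inl None, t :: w) >>.
  by rewrite rbMU /rb_lbl /= (dcons_lbl (inl t)) (ten_lbl (inl None)).
have rb1_b y : rb1 (model_gen_lin (b y)) = << (inl (Some y), [::]) >>.
  by rewrite model_rb1 /= /model_gen rbM_plain1 (ten_lbl (inl (Some y))).
have rb1_code_op p : rb1 (<< code_op p >> : model) =
    << (inl None, rcons p.1 (Some p.2)) >>.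
  by rewrite model_rb1 /code_op; case: p => [[|t s] y]; rewrite rbM_inl.
have eval_opE s x : eval_op model_gen_lin b (s, x) = << code_op (s, x) >>.
  elim: s => [|[y|] s IH]; first exact: rb1_b.
    rewrite eval_op_some rb1_b IH rb1_code_op -[rb_mul _ _ _]/(mmul _ _).
    rewrite -(ten_lbl (inl (Some y))) -(ten_lbl (inl None)) mmul_ten emulE1 dmul1.
    by rewrite (ten_lbl (inl (Some y))).
  by rewrite eval_op_none IH rb1_code_op.
case: q => [[s x]|[x [[s y]|]]]; [exact: eval_opE | | exact: (ten_lbl (inr x))].
rewrite eval_word_some eval_opE rb1_code_op -[rb_mul _ _ _]/(mmul _ _) /= /model_gen.
by rewrite -(ten_lbl (inl None)) mmul_ten emulE1 dmul1 (ten_lbl (inr x)).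
Qed.

(** The bound holds on monomials because generators have degree at most 1, degree bounds add up in
    products, and R does not raise them. *)
Lemma model_filt (Y : Type) (U : rbComAlg lam) (i : Y -> U)
    (mu : {linear U -> model}) n u :
  is_rb_hom mu -> (forall y, exists a, mu (i y) = model_gen a) ->
  u \in filt i n -> deg_le mdeg n (mu u).
Proof.
move=> [muM muR] mui /asboolP[k [c [v [vP ->]]]].
have monomial_deg m w : monomial_value i m w -> deg_le mdeg m (mu w).
  elim=> {m w} [y|m m' w w' _ mw _ mw'|m w _ mw].
  - have [a ->] := mui y; apply: (@ten_deg 1 0); first by [].
    exact: deg_leU.
  - by rewrite muM; exact: mmul_deg.
  - by rewrite muR; apply/deg_leZ/rbM_deg.
rewrite linear_sum; elim/big_rec: _ => [|j w _ mw]; first exact: deg_le0.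
apply: deg_leD => //; rewrite linearZ; apply: deg_leZ.
by have [m mn /monomial_deg] := vP j; move/deg_leW; apply.
Qed.

End ModelAlgebra.

End Model.

(** * The associated graded algebra *)

Section Comparison.
Variables (K : fieldType) (lam : K) (lam0 : lam != 0) (A : postCom K).
Variables (U : rbComAlg lam) (i : {linear A -> U}).
Hypothesis i_hom : is_pc_hom (B := psi lam0 U) i.

Lemma filt_gen a : i a \in filt i 1.
Proof. by apply/asboolP/in_span_gen; exists 1%N => //; exact: MVgen. Qed.

Definition gr_gen (a : Ab A) : gr i := sing i 1 (i a).

Fact gr_gen_linear : linear gr_gen.
Proof. by move=> c x y; rewrite /gr_gen linearP singP ?filt_gen. Qed.

HB.instance Definition _ :=
  GRing.isLinear.Build K (Ab A) (gr i) *:%R gr_gen gr_gen_linear.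

Definition gr_gen_lin : {linear Ab A -> gr i} := gr_gen.

(** The products of two generators come from A, hence lie in [filt i 1] and vanish in degree 2, as
    required by the zero operations of [Ab A]. *)
Lemma gr_gen_hom : is_pc_hom (A := Ab A) (B := psi lam0 (gr i)) gr_gen_lin.
Proof.
have [iS iT] := i_hom; split=> x y; rewrite [LHS](linear0 gr_gen_lin).
  rewrite /= /psi_succ /= /gr_gen sing_op ?sing_mul ?filt_op ?filt_gen //.
  rewrite sing_lower ?scaler0 // -[rb_mul _ _ _]scale1r -(mulfV lam0) -scalerA.
  by rewrite rpredZ // -[_ *: _]iS filt_gen.
by rewrite /= /gr_gen sing_mul ?filt_gen // sing_lower // -[rb_mul _ _ _]iT filt_gen.
Qed.

Section Words.
Variables (X : choiceType) (b : X -> A).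

(** [None] counts nothing, as R does not change the degree; the successor counts the last letter. *)
Definition pdeg (p : seq (option X) * X) : nat := (count isSome p.1).+1.

Definition qdeg (q : word X) : nat :=
  match q with
  | inl p => pdeg p
  | inr (x, None) => 1
  | inr (x, Some p) => (pdeg p).+1
  end.

Lemma qdeg_gt0 q : (0 < qdeg q)%N. Proof. by case: q => [p|[x [p|]]]. Qed.

Lemma filt_rb1 n u : u \in filt i n -> rb1 u \in filt i n.
Proof. by move=> un; rewrite rpredZ ?filt_op. Qed.

Lemma sing_rb1 n u : u \in filt i n -> rb1 (sing i n u : gr i) = sing i n (rb1 u).
Proof.
by move=> un; rewrite /rb1 sing_op // singZ ?filt_op.
Qed.

Lemma eval_word_gr q : eval_word i b q \in filt i (qdeg q) /\
  eval_word gr_gen_lin (b : X -> Ab A) q = sing i (qdeg q) (eval_word i b q).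
Proof.
have rb1_b x : rb1 (i (b x)) \in filt i 1 /\
    rb1 (gr_gen_lin (b x)) = sing i 1 (rb1 (i (b x))).
  by rewrite [gr_gen_lin _]/(sing i 1 (i (b x))) sing_rb1 ?filt_rb1 ?filt_gen.
have eval_op_gr s x : eval_op i b (s, x) \in filt i (pdeg (s, x)) /\
    eval_op gr_gen_lin (b : X -> Ab A) (s, x) =
      sing i (pdeg (s, x)) (eval_op i b (s, x)).
  elim: s => [|[y|] s [IHf IHs]]; first exact: rb1_b.
    have [bf bs] := rb1_b y; rewrite !eval_op_some IHs bs sing_rb1 //.
    rewrite sing_mul ?filt_rb1 ?filt_gen //; split=> //.
    by apply: (filt_mul (m := 1) (n := pdeg (s, x))); rewrite ?filt_rb1 ?filt_gen.
  by rewrite !eval_op_none IHs sing_rb1 ?filt_rb1.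
case: q => [[s x]|[x [[s y]|]]]; [exact: eval_op_gr | | by rewrite filt_gen].
have [pf ps] := eval_op_gr s y; rewrite !eval_word_some ps.
rewrite [gr_gen_lin _]/(sing i 1 (i (b x))) sing_rb1 // sing_mul ?filt_rb1 ?filt_gen //.
split=> //; apply: (filt_mul (m := 1) (n := pdeg (s, y))).
  exact: filt_gen.
exact: filt_rb1.
Qed.

Lemma represents_ext (f : dsum (grp i)) u v :
  represents f u -> u =1 v -> represents f v.
Proof. by move=> fu uv n; rewrite -uv. Qed.

(** Lets a relation between words in the graded algebra be tested degree by degree in [U]. *)
Lemma represents_lext (g : {malg K[word X]}) :
  represents (lext (eval_word gr_gen_lin (b : X -> Ab A)) g : dsum (grp i))
    (fun n => lext (fun q => if n == qdeg q then eval_word i b q else 0) g).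
Proof.
elim/malg_lin_ind: g => [|c g h IHg IHh|q].
- by rewrite linear0 => n; rewrite linear0 rpred0 grp_cls0.
- rewrite linearP; apply: represents_ext (represents_lin c IHg IHh) _ => n.
  by rewrite linearP.
rewrite lextU; have [qf ->] := eval_word_gr q.
by apply: represents_ext (represents_sing qf) _ => n; rewrite lextU.
Qed.

End Words.

Section Surjectivity.
Variables (V : rbComAlg lam) (j : {linear Ab A -> V}) (phi : {linear V -> gr i}).
Hypothesis phi_hom : is_rb_hom phi.
Hypothesis phi_j : forall a, phi (j a) = gr_gen a.

(** The associated graded algebra is generated by the classes of [i a] in degree 1, which [phi]
    reaches. *)
Lemma phi_surj (y : gr i) : exists x, phi x = y.
Proof.
have [phiM phiR] := phi_hom.
pose im y := exists x, phi x = y.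
have im_lin c u v : im u -> im v -> im (c *: u + v).
  by move=> [x <-] [x' <-]; exists (c *: x + x'); rewrite linearP.
have im0 : im 0 by exists 0; rewrite linear0.
have monomial_filt m v : monomial_value i m v -> v \in filt i m.
  by move=> mv; apply/asboolP/in_span_gen; exists m.
have im_monomial m v : monomial_value i m v -> im (sing i m v).
  elim=> {m v} [a|m n u v mu [x xE] nv [x' x'E]|m u mu [x xE]].
  - by exists (j a).
  - exists (rb_mul V x x'); rewrite phiM xE x'E sing_mul //; exact: monomial_filt.
  - by exists (rb_op V x); rewrite phiR xE sing_op //; exact: monomial_filt.
have im_sing n u : u \in filt i n -> im (sing i n u).
  move=> /asboolP[k [c [v [vP ->]]]].
  suff [] : \sum_(l < k) c l *: v l \in filt i n /\
      im (sing i n (\sum_(l < k) c l *: v l)) by [].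
  elim/big_rec: _ => [|l w _ [wn imw]].
    by rewrite rpred0 sing0.
  have [m mn mv] := vP l; have vm := monomial_filt _ _ mv.
  have vn := filtW mn vm; split; first by rewrite rpredD ?rpredZ.
  rewrite singP //; apply: im_lin => //.
  (* A monomial of smaller degree has zero class in degree [n]. *)
  case: ltngtP mn => // [mn _|mE _]; last by rewrite -mE; apply: im_monomial.
  have n0 := leq_ltn_trans (leq0n m) mn.
  by rewrite -(prednK n0) sing_lower // (filtW _ vm) // -ltnS prednK.
(* Induction on a bound for the support; the top component is removed at each step. *)
suff im_bound N : forall f : dsum (grp i), (forall n, (N <= n)%N -> f n = 0) -> im f.
  by case: y => f [N fN]; apply: (im_bound N).
elim: N => [|N IH] f fN.
  by have -> : f = 0 by apply: dsumP => n; apply: fN.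
have [un uE] := grp_rep (f N); set u := filt_val _ in un uE.
have -> : f = 1 *: (f - sing i N u : dsum (grp i)) + sing i N u.
  by rewrite scale1r subrK.
apply: im_lin; last exact: im_sing.
apply: IH => n Nn; rewrite dsumDE [X in _ + X]/=; have [->|nN] := eqVneq n N.
  by rewrite -uE subrr.
by rewrite fN ?grp_cls0 ?subr0 // ltn_neqAle eq_sym nN.
Qed.

End Surjectivity.
End Comparison.

(** Since the degree is exactly [qdeg q], this basis vector cannot occur in elements of smaller
    degree. *)
Lemma mdeg_code_word (X : choiceType) (q : word X) : mdeg (code_word q) = qdeg q.
Proof.
have count_rcons s (y : X) : count isSome (rcons s (Some y)) = (count isSome s).+1.
  by rewrite -cats1 count_cat addn1.
case: q => [[[|[y|] s] x]|[x [[s y]|]]];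
  by rewrite /mdeg /wdeg /qdeg /pdeg /= ?count_rcons.
Qed.

Lemma mcoeff_lext_inj (K : fieldType) (X Y : choiceType) (e : X -> Y)
    (P : pred X) (g : {malg K[X]}) x : injective e -> P x ->
  (lext (fun y => if P y then << e y >> else 0) g : {malg K[Y]})@_(e x) = g@_x.
Proof.
move=> e_inj Px; elim/malg_lin_ind: g => [|c g h IHg IHh|y].
- by rewrite linear0 !mcoeff0.
- by rewrite linearP !mcoeffD !mcoeffZ IHg IHh.
rewrite lextU mcoeffU; have [->|yx] := eqVneq y x.
  by rewrite Px mcoeffUU.
by case: (P y); rewrite ?mcoeff0 // mcoeffU (inj_eq e_inj) (negPf yx).
Qed.

Lemma rb_isomorphic_inv (K : fieldType) (lam : K) (B C : rbComAlg lam)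
    (f : {linear B -> C}) :
  is_rb_hom f -> bijective f -> rb_isomorphic C B.
Proof.
move=> [fM fR] [g fK gK].
have g_lin : linear g by move=> c x y; apply: (can_inj fK); rewrite linearP !gK.
pose gL : {linear C -> B} :=
  HB.pack g (GRing.isLinear.Build K C B *:%R g g_lin).
exists gL; split; last by exists f.
by split=> [x y|x]; apply: (can_inj fK); rewrite ?fM ?fR !gK.
Qed.

Theorem corollary2 (K : fieldType) (lam : K) (lam0 : (lam != 0)%R) :
  rbCom_postCom_PBW_pair lam0.
Proof.
move=> A U i V j iU jV; have [i_hom i_univ] := iU; have [j_hom j_univ] := jV.
have [phi [phi_hom phi_j _]] := j_univ _ _ (gr_gen_hom i_hom).
apply: (rb_isomorphic_inv phi_hom).
have phi_onto := phi_surj phi_hom phi_j.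
suff phi_inj x : phi x = 0 -> x = 0.
  have [psi psiK] : exists psi : gr i -> V, forall y, phi (psi y) = y.
    by exists (fun y => sval (cid (phi_onto y))) => y; case: cid.
  exists psi => // x; apply/eqP; rewrite -subr_eq0; apply/eqP/phi_inj.
  by rewrite linearB psiK subrr.
have [X [b [crd [crd_b b_crd]]]] := hamel_basis (pc_car A).
have [g ->] :=
  @nf_span_range _ _ (Ab A) V j X b crd b_crd x (enveloping_nf_span jV x).
move=> phig0; suff -> : g = 0 by rewrite linear0.
have [mu [mu_hom mu_i _]] := i_univ _ _ (model_gen_hom crd_b b_crd lam0).
(* The part of [g] of degree [n], evaluated in [U] and not in [V]. *)
pose h n := lext (fun q => if n == qdeg q then eval_word i b q else 0) g.
(* The component of degree [n] of the image under [phi] is the class of [h n]; its vanishing lowers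
   [h n] by one filtration step. *)
have h_low n : h n \in filt i n.-1.
  have phig : phi (lext (eval_word j (b : X -> Ab A)) g) =
      lext (eval_word (gr_gen_lin i) (b : X -> Ab A)) g.
    elim/malg_lin_ind: g {phig0 h} => [|c g g' IH IH'|q]; first by rewrite !linear0.
      by rewrite !linearP IH IH'.
    rewrite !lextU.
    exact: (eval_word_hom (b' := b : X -> Ab A) phi_hom (fun x => phi_j (b x))).
  have [hn] := represents_lext i b g n.
  rewrite -phig phig0 => /esym; rewrite -[X in _ = X -> _](grp_cls0 i).
  by move/grp_cls_eq; rewrite subr0; apply; rewrite ?rpred0.
apply/malgP => q; rewrite mcoeff0.
have mu_h n : mu (h n) = lext (fun q => if n == qdeg q then << code_word q >> else 0) g.
  rewrite /h; elim/malg_lin_ind: g {phig0 h h_low} => [|c g g' IH IH'|q'].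
  - by rewrite !linear0.
  - by rewrite !linearP IH IH'.
  - rewrite !lextU; case: eqP => _; last by rewrite linear0.
    rewrite (eval_word_hom (b' := b) mu_hom (fun x => mu_i (b x))).
    exact: eval_word_model.
(* [mu] respects degrees, so the drop in filtration carries over to the model. *)
have mu_deg : deg_le (@mdeg X) (qdeg q).-1 (mu (h (qdeg q))).
  by apply: (model_filt mu_hom _ (h_low _)) => a; exists a; rewrite mu_i.
(* The coefficient of [g] at [q] is that of the image at [code_word q], of degree [qdeg q];
   positivity of [qdeg q] makes the predecessor strictly smaller. *)
rewrite -(@mcoeff_lext_inj _ _ _ _ (fun q' => qdeg q == qdeg q') g q
  (@code_word_inj X)) ?eqxx //.
by rewrite -mu_h mu_deg // mdeg_code_word prednK // qdeg_gt0.
Qed.
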